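(* Let $G$ be a $2$-connected outerplane graph of order $n$ whose internal faces all have length at most $\frac{n+2}{4}$. Then $$\mathrm{rad}(G) \leq \left\lfloor \frac{n}{4} \right\rfloor + 1.$$
   Context: All graphs are finite, simple and connected. The order of a graph is its number of vertices. A graph is $2$-connected if it is connected, has at least three vertices, and remains connected after deletion of any single vertex. A graph is outerplanar if it can be embedded in the plane without edge crossings so that every vertex lies on the boundary of the exterior (unbounded) region; an outerplane graph is an outerplanar graph together with such an embedding. Internal faces are the faces other than the exterior one. In a $2$-connected outerplane graph each internal face is bounded by a cycle, whose length is the length of the face. The radius of $G$ is $\mathrm{rad}(G)=\min_{v\in V(G)}\max_{u\in V(G)} d_G(v,u)$, where $d_G$ is the shortest-path distance. *)

(* Defs.v *)
From HB Require Import structures.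
From mathcomp Require Import all_boot all_order all_algebra.
From mathcomp Require Import all_classical all_reals all_analysis.

Set Implicit Arguments.
Unset Strict Implicit.
Unset Printing Implicit Defensive.

Import Order.TTheory GRing.Theory Num.Theory.
Import numFieldNormedType.Exports.

Local Open Scope classical_set_scope.
Local Open Scope ring_scope.

Section Graphs.
Context {V : finType}.
Implicit Types (e : rel V) (A : pred V) (c : seq V).

Definition simple_graph e : Prop := symmetric e /\ irreflexive e.

(* The subgraph induced on A is connected. *)
Definition connected_on e A : Prop :=
  forall x y, A x -> A y ->
    connect [rel u v | [&& A u, A v & e u v]] x y.

Definition two_connected e : Prop :=
  [/\ (3 <= #|V|)%N, connected_on e predT
    & forall w, connected_on e (predC1 w)].

Definition graph_cycle e c : Prop := (3 <= size c)%N /\ ucycle e c.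

Definition has_walk e (x y : V) (k : nat) : bool :=
  [exists p : k.-tuple V, path e x p && (last x p == y)].

(* Shortest-path distance: [find] returns the least k < #|V| for which there
   is a walk of length k, and #|V| if y cannot be reached from x. *)
Definition gdist e (x y : V) : nat := find (has_walk e x y) (iota 0 #|V|).

Definition eccentricity e (v : V) : nat := (\max_(u : V) gdist e v u)%N.

(* Eccentricities never exceed #|V|, so the default value of this minimum
   matters only for the empty graph. *)
Definition graph_radius e : nat := \big[minn/#|V|]_(v : V) eccentricity e v.

End Graphs.

Section PlaneDrawings.
Context {R : realType}.
Local Notation plane := (R * R)%type.

(* A is a simple (Jordan) arc with ends a and b. *)
Definition is_arc (a b : plane) (A : set plane) : Prop :=
  exists g : R -> plane,
    [/\ {within `[0, 1], continuous g}, {in `[0, 1] &, injective g},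
        g 0 = a, g 1 = b & A = g @` `[0, 1]].

Definition boundary (A : set plane) : set plane := closure A `&` closure (~` A).

Context {V : finType} (e : rel V).
Variables (pt : V -> plane) (arc : V -> V -> set plane).

(* Vertices are distinct points, the edge uv is an arc from pt u to pt v (the
   values of [arc] on non-adjacent pairs are irrelevant), an edge meets the
   vertex set only in its ends, and distinct edges meet only in vertices. *)
Definition plane_drawing : Prop :=
  [/\ injective pt,
      forall u v, e u v -> is_arc (pt u) (pt v) (arc u v) /\ arc u v = arc v u,
      forall u v w, e u v -> arc u v (pt w) -> w = u \/ w = v
    & forall u v x y, e u v -> e x y ->
        (u, v) <> (x, y) -> (u, v) <> (y, x) ->
        arc u v `&` arc x y `<=` range pt].

Definition drawing_support : set plane :=
  [set p | (exists v, p = pt v) \/ (exists u v, e u v /\ arc u v p)].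

(* The faces are the regions (connected components) of the complement. *)
Definition face (F : set plane) : Prop :=
  exists2 p, ~ drawing_support p
           & F = connected_component (~` drawing_support) p.

Definition exterior_face (F : set plane) : Prop := face F /\ ~ bounded_set F.

Definition internal_face (F : set plane) : Prop := face F /\ bounded_set F.

Definition outerplane : Prop :=
  plane_drawing /\
  exists F, exterior_face F /\ forall v, boundary F (pt v).

Definition cycle_curve (c : seq V) : set plane :=
  [set p | exists2 v, v \in c & arc v (next c v) p].

(* F is bounded by a cycle of the graph, of length l. *)
Definition face_length (F : set plane) (l : nat) : Prop :=
  exists c, [/\ graph_cycle e c, boundary F = cycle_curve c & size c = l].

End PlaneDrawings.

(* Main.v *)
(** For a compact set [K] and a point [a] off [K], consider continuous angles of
    [z - a] for [z] in [K]. Such an angle exists when [a] lies in an unbounded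
    component of the complement of [K], or when [K] is an arc, and two of them
    glue along a connected intersection; none exists when [a] lies in a bounded
    open set whose frontier is contained in [K]. This gives, for a cycle [C] of
    the drawing, a bounded component of the complement of [C], and shows that the
    boundary of every such component is all of [C]. Since every vertex is on the
    exterior face, no vertex lies in such a component, and therefore neither does
    any edge with an end off [C]. Hence an induced cycle bounds an internal face,
    and there is no theta whose three paths all have interior vertices: gluing
    angles along the third path would give a point of a bounded component of the
    first two paths an angle. Thus a longest cycle of the 2-connected graph is
    Hamiltonian.

    In the Hamiltonian cycle take an edge or chord cutting off, on one side, an
    arc of more than about [n / 2] edges, as short as possible. A shortest path
    along this arc closes up with the chord to an induced cycle of length
    [l <= (n + 2) / 4], and the Hamiltonian cycle is cut by its vertices into
    segments of at most [n / 2] interior vertices. At most two of the segments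
    are too long to be reached within [n / 4 + 1] from every vertex of the
    induced cycle, and a suitable vertex between these two reaches everything. *)

Require Import Defs.
From mathcomp Require Import all_boot all_order all_algebra.
From mathcomp Require Import all_classical all_reals all_analysis.
From mathcomp Require Import zify ring lra.

Set Implicit Arguments.
Unset Strict Implicit.
Unset Printing Implicit Defensive.

(** * Hamiltonian cycles from the absence of thetas *)

Section Hamiltonian.
Context {V : finType} (e : rel V).
Hypothesis e_sym : symmetric e.
Hypothesis tc : two_connected e.
Hypothesis no_theta : forall a b s1 s2 s3,
  path e a (rcons s1 b) -> path e a (rcons s2 b) -> path e a (rcons s3 b) ->
  s1 <> [::] -> s2 <> [::] -> s3 <> [::] -> ~ uniq (a :: b :: s1 ++ s2 ++ s3).
Implicit Types (u v w x y : V) (c s p : seq V).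

Lemma path_exit (r : rel V) (A : pred V) x p : path r x p -> A x -> ~~ A (last x p) ->
  exists u w, [/\ A u, ~~ A w & r u w].
Proof.
elim: p x => [|y p IH] x /=; first by move=> _ ->.
move=> /andP[xy yp] Ax An; have [Ay|Ay] := boolP (A y); first exact: IH yp Ay An.
by exists x, y.
Qed.

Lemma path_first_hit (A : pred V) x p : A (last x p) -> ~~ A x ->
  exists p1 b p2, [/\ p = p1 ++ b :: p2, A b & ~~ has A (x :: p1)].
Proof.
elim: p x => [|y p IH] x /=; first by move=> ->.
move=> Al Ax; have [Ay|Ay] := boolP (A y).
  by exists [::], y, p; rewrite /= (negPf Ax).
have [p1 [b [p2 [-> Ab h]]]] := IH y Al Ay.
by exists (y :: p1), b, p2; rewrite /= (negPf Ax) /= in h *.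
Qed.

(** A walk towards [v] leaves [c] along an edge from [a] to [w]. Deleting [a] keeps the graph
    connected, so [w] is joined without [a] to another vertex of [c]; the path is cut at its first
    return to [c]. *)
Lemma ear c v : (2 <= size c)%N -> uniq c -> v \notin c ->
  exists a b w p, [/\ [/\ a \in c, b \in c & a <> b], path e a (rcons (w :: p) b),
    uniq (w :: p) & ~~ has (mem c) (w :: p)].
Proof.
case: c => [|x [|x' c]] // _ uc vc.
have [_ cT cC] := tc.
have [p ep lp] := connectP (cT x v isT isT).
have [||a [w [ac wc /andP[_ /andP[_ aw]]]]] := path_exit (A := mem (x :: x' :: c)) ep.
- exact: mem_head.
- by rewrite -lp.
have [d dc da] : exists2 d, d \in x :: x' :: c & d != a.
  have [<-|xa] := eqVneq x a; last by exists x => //; exact: mem_head.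
  exists x'; first by rewrite !in_cons eqxx orbT.
  by move: uc => /= /andP[]; rewrite in_cons negb_or eq_sym => /andP[].
have wa : w != a by apply: contraNneq wc => ->.
have [q eq_ lq] := connectP (cC a w d wa da).
case/shortenP: eq_ lq => q' eq' uq' _ lq'.
have lc : last w q' \in x :: x' :: c by rewrite -lq'.
have [p1 [b [p2 [qE bc hp]]]] := path_first_hit (A := mem (x :: x' :: c)) lc wc.
rewrite qE in eq' uq'.
exists a, b, w, p1; split => //.
- split => // ab; move: eq'; rewrite cat_path /= => /and3P[_ /and3P[_ + _] _].
  by rewrite ab eqxx.
- rewrite /= aw /=; move: eq'; rewrite cat_path /= => /and3P[ep1 /and3P[_ _ lb] _].
  rewrite rcons_path lb andbT; apply: sub_path ep1 => y z; by case/and3P.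
- by move: uq'; rewrite -cat_cons cat_uniq => /and3P[].
Qed.

(** The ends of an ear split the cycle into sides [s1] and [s2]. If one is empty, the ear replaces
    an edge and lengthens the cycle; otherwise the two sides and the ear form a theta. *)
Lemma longer_cycle c v : (2 <= size c)%N -> ucycle e c -> v \notin c ->
  exists c', ucycle e c' /\ (size c < size c')%N.
Proof.
move=> c2 /andP[cc uc] vc.
have [a [b [w [p [[ac bc ab] ep up hp]]]]] := ear c2 uc vc.
have [i c' rE] := rot_to ac.
have := rot_cycle i e c; have := rot_uniq i c; have := size_rot i c; have := mem_rot i c.
rewrite rE cc uc => mc sz; move: bc; rewrite -mc in_cons => /orP[/eqP /esym //|bc'].
have {}hp : ~~ has (mem (a :: c')) (w :: p).
  by apply: contra hp; apply: sub_has => y /=; rewrite -mc.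
case/splitPr: bc' sz mc hp {rE} => s1 s2 sz _ hp uc' cc'.
set q := w :: p in ep up hp.
have dj y : y \in q -> [/\ y != a, y != b, y \notin s1 & y \notin s2].
  move=> yq; have := hasPn hp y yq; rewrite /= in_cons mem_cat in_cons !negb_or.
  by move=> /and4P[].
have perm_q t1 t2 : perm_eq (t1 ++ t2) (a :: s1 ++ b :: s2) -> uniq (t1 ++ q ++ t2).
  move=> pq; rewrite (@perm_uniq _ _ (q ++ t1 ++ t2)); last by rewrite perm_catCA.
  rewrite cat_uniq up (perm_uniq pq) uc' andbT /=.
  by rewrite (perm_has _ pq) has_sym.
move: cc'; rewrite /= rcons_cat cat_path /= => /and3P[es1 es1b es2].
have ps1 : path e a (rcons s1 b) by rewrite rcons_path es1.
have [s10|s10] := eqVneq s1 [::].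
  exists (a :: q ++ b :: s2); split.
    apply/andP; split; last by apply: (perm_q [:: a] (b :: s2)); rewrite s10.
    suff : path e a (rcons (q ++ b :: s2) a) by [].
    by rewrite rcons_cat rcons_cons -cat_rcons cat_path ep last_rcons es2.
  by rewrite -sz s10 /= !size_cat /=; clear; lia.
have eq_rev : path e b (rcons (rev q) a).
  have := rev_path e a (rcons q b); rewrite last_rcons belast_rcons rev_cons => ->.
  by apply: sub_path ep => y z; rewrite e_sym.
have [s20|s20] := eqVneq s2 [::].
  exists (a :: s1 ++ b :: rev q); split.
    apply/andP; split.
      suff : path e a (rcons (s1 ++ b :: rev q) a) by [].
      by rewrite rcons_cat rcons_cons -cat_rcons cat_path ps1 last_rcons eq_rev.
    have := perm_q (a :: s1 ++ [:: b]) [::]; rewrite cats0 s20 => /(_ (perm_refl _)).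
    rewrite cats0; congr (is_true _); apply: perm_uniq.
    by rewrite -cat_cons -cat_cons -catA perm_cat2l /= perm_cons perm_sym perm_rev.
  by rewrite -sz s20 /= !size_cat /= size_rev /q /=; clear; lia.
exfalso.
have ps2 : path e a (rcons (rev s2) b).
  have := rev_path e b (rcons s2 a); rewrite last_rcons belast_rcons rev_cons => ->.
  by apply: sub_path es2 => y z; rewrite e_sym.
apply: (no_theta ps1 ps2 ep).
- exact/eqP.
- by move=> /(congr1 size); rewrite size_rev => /eqP; rewrite size_eq0; apply/negP.
- by [].
have := perm_q (a :: s1 ++ b :: s2) [::]; rewrite cats0 => /(_ (perm_refl _)).
rewrite cats0; congr (is_true _); apply: perm_uniq.
rewrite /= perm_cons -catA /= -[b :: s2 ++ q]cat1s perm_catCA /= perm_cons perm_cat2l.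
by rewrite perm_cat2r perm_sym perm_rev.
Qed.

Lemma hamiltonian_cycle : exists c, graph_cycle e c /\ forall v, v \in c.
Proof.
have [V3 cT _] := tc.
have [x [y xy]] : exists x y : V, x != y.
  have /card_gt1P[x [y [_ _ xy]]] : (1 < #|V|)%N by exact: ltn_trans V3.
  by exists x, y.
have [a [b ab]] : exists a b, e a b && (a != b).
  have [p ep lp] := connectP (cT x y isT isT).
  have [||a [b [ax bx /andP[_ /andP[_ ab]]]]] := path_exit (A := pred1 x) ep.
  - exact: eqxx.
  - by rewrite -lp /= eq_sym.
  by exists a, b; rewrite ab /= (eqP ax) eq_sym.
case/andP: ab => ab ab'.
(* Induction on the number of missing vertices, started from an edge run back and forth, which
   [ucycle] accepts as a cycle of size two. *)
have main k c : (#|V| - size c <= k)%N -> (2 <= size c)%N -> ucycle e c ->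
    exists c, ucycle e c /\ forall v, v \in c.
  elim: k c => [|k IH] c ck c2 uc.
    exists c; split => // v; have [//|vc] := boolP (v \in c).
    have [c' [/andP[_ uc'] c'c]] := longer_cycle c2 uc vc.
    by have := max_card (mem c'); rewrite (card_uniqP uc'); lia.
  have [/forallP h|] := boolP [forall v, v \in c]; first by exists c.
  rewrite negb_forall => /existsP[v vc].
  have [c' [uc' c'c]] := longer_cycle c2 uc vc.
  by apply: (IH c') => //; lia.
have [|//||c [uc cV]] := main #|V| [:: a; b].
- exact: leq_subr.
- by rewrite /ucycle /= ab e_sym ab /= mem_seq1 ab'.
exists c; split => //; split => //.
by have /andP[_ uc'] := uc; rewrite -(card_uniqP uc') (eq_card (B := V)).
Qed.

End Hamiltonian.

(** * Radius of a Hamiltonian graph with short induced cycles *)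

Section Distances.
Context {V : finType} (e : rel V).
Hypothesis e_sym : symmetric e.
Implicit Types (x y z : V) (k : nat).

Definition reach k x y : Prop := exists p, [/\ path e x p, last x p = y & (size p <= k)%N].

Lemma reach_refl x : reach 0 x x. Proof. by exists [::]. Qed.

Lemma reach_edge x y : e x y -> reach 1 x y.
Proof. by move=> xy; exists [:: y]; rewrite /= xy. Qed.

Lemma reach_le k l x y : (k <= l)%N -> reach k x y -> reach l x y.
Proof. by move=> kl [p [h1 h2 h3]]; exists p; split => //; exact: leq_trans kl. Qed.

Lemma reach_trans k l x y z : reach k x y -> reach l y z -> reach (k + l) x z.
Proof.
move=> [p [h1 h2 h3]] [q [h4 h5 h6]]; exists (p ++ q).
by rewrite cat_path h1 h2 last_cat h2 size_cat leq_add.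
Qed.

Lemma reach_sym k x y : reach k x y -> reach k y x.
Proof.
move=> [p [h1 h2 h3]]; exists (rev (belast x p)); split.
- by rewrite -h2 rev_path; apply: sub_path h1 => a b; rewrite e_sym.
- by case: (p) h2 => [<-//|a p' _] /=; rewrite rev_cons last_rcons.
- by rewrite size_rev size_belast.
Qed.

Lemma reach_walk (h : nat -> V) i j : (i <= j)%N -> (forall l, (i <= l < j)%N -> e (h l) (h l.+1)) ->
  reach (j - i) (h i) (h j).
Proof.
elim: j => [|j IH]; first by rewrite leqn0 => /eqP-> _; exact: reach_refl.
rewrite leq_eqVlt => /predU1P[->|ij] H; first by rewrite subnn; exact: reach_refl.
rewrite subSn; last by lia.
rewrite -addn1; apply: (@reach_trans _ _ _ (h j)).
  by apply: IH; [lia | move=> l hl; apply: H; lia].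
by apply: reach_edge; apply: H; lia.
Qed.

Lemma gdist_le k x y : reach k x y -> (gdist e x y <= k)%N.
Proof.
move=> [p [h1 h2 h3]]; apply: leq_trans h3; rewrite /gdist leqNgt; apply/negP => h.
have hs : (size p < #|V|)%N.
  by apply: (leq_trans h); rewrite -[leqRHS](size_iota 0); exact: find_size.
have hw : has_walk e x y (size p).
  by apply/existsP; exists (in_tuple p); rewrite h1 h2 eqxx.
by have := before_find 0%N h; rewrite nth_iota// add0n hw.
Qed.

Lemma graph_radius_le k v : (forall u, reach k v u) -> (graph_radius e <= k)%N.
Proof.
move=> H; apply: (@leq_trans (eccentricity e v)); last first.
  by apply/bigmax_leqP => u _; apply: gdist_le.
rewrite /graph_radius; have : v \in index_enum V by rewrite mem_index_enum.
elim: (index_enum V) => // w s IH; rewrite in_cons big_cons.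
by move=> /predU1P[->|/IH h]; rewrite geq_min ?leqnn// h orbT.
Qed.

End Distances.

(** * Choice of a centre on a cycle inscribed in a longer one *)

Section Center.
Context {V : finType} (e : rel V).
Hypothesis e_sym : symmetric e.
Variables (l n : nat) (U : nat -> nat) (g : nat -> V).
Hypothesis l_gt0 : (0 < l)%N.
Hypothesis U0 : U 0 = 0%N.
Hypothesis Ul : U l = n.
Hypothesis U_lt : forall j, (j < l)%N -> (U j < U j.+1)%N.
Hypothesis g_edge : forall s, e (g s) (g s.+1).
Hypothesis g_per : g n = g 0.
Hypothesis gU_edge : forall j, (j < l)%N -> e (g (U j)) (g (U j.+1)).

(** [U] gives the positions, on the closed walk [g] of length [n], of the [l] vertices of the
    inscribed cycle. Reading [vtx] modulo [l] lets walks on that cycle pass index [l]. *)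
Let vtx j := g (U (j %% l)).
Let gap j := (U j.+1 - U j)%N.
Let k := (n %/ 4)%N.

Lemma segment_gap i j : (i <= j <= l)%N -> (U i + (j - i) <= U j)%N.
Proof.
elim: j => [|j IH] h; first by have -> : i = 0%N; [lia | rewrite subnn addn0].
have [->|ij] := eqVneq i j.+1; first by lia.
by have := IH ltac:(lia); have := U_lt (j := j) ltac:(lia); lia.
Qed.

Lemma segment_cover s : (s < n)%N -> exists2 j, (j < l)%N & (U j <= s <= U j.+1)%N.
Proof.
move=> sn.
have : exists j, (s < U j)%N by exists l; rewrite Ul.
move=> /ex_minnP[[|j] sj jmin]; first by rewrite U0 in sj.
have jl : (j.+1 <= l)%N by apply: jmin; rewrite Ul.
exists j => //; apply/andP; split; last exact: ltnW.
by rewrite leqNgt; apply/negP => /jmin; rewrite ltnn.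
Qed.

Lemma vtxE j : (j <= l)%N -> vtx j = g (U j).
Proof.
rewrite leq_eqVlt => /predU1P[->|jl]; last by rewrite /vtx modn_small.
by rewrite /vtx modnn U0 Ul.
Qed.

Lemma vtx_edge j : e (vtx j) (vtx j.+1).
Proof.
have jl : (j %% l < l)%N by rewrite ltn_mod.
have -> : vtx j.+1 = g (U (j %% l).+1).
  rewrite -vtxE//; rewrite /vtx; congr (g (U _)).
  by rewrite -[in RHS]addn1 modnDml addn1.
exact: gU_edge.
Qed.

Lemma vtx_reach i j : (i <= j)%N -> reach e (j - i) (vtx i) (vtx j).
Proof. by move=> ij; apply: reach_walk => // m _; exact: vtx_edge. Qed.

Lemma vtx_reachC i j : (j <= i)%N -> reach e (i - j) (vtx i) (vtx j).
Proof. by move=> ji; apply: (reach_sym e_sym); exact: vtx_reach. Qed.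

Lemma vtx_per j : vtx (j + l) = vtx j.
Proof. by rewrite /vtx modnDr. Qed.

(** A vertex of the segment is reached from [vtx i] through either end. The two walks have total
    length [gap j + a + b], so a total of at most [2 * k + 3] makes one of them at most [k + 1]
    long. *)
Definition near_segment i j : Prop := exists a b,
  [/\ reach e a (vtx i) (vtx j), reach e b (vtx i) (vtx j.+1) & (gap j + a + b <= 2 * k + 3)%N].

Lemma near_segment_reach i j s : (j < l)%N -> near_segment i j -> (U j <= s <= U j.+1)%N ->
  reach e (k + 1) (vtx i) (g s).
Proof.
move=> jl [a [b [ra rb ab]]] /andP[js sj].
rewrite (vtxE (ltnW jl)) in ra; rewrite (vtxE jl) in rb.
have r1 := reach_trans ra (reach_walk (h := g) js (fun m _ => g_edge m)).
have r2 := reach_trans rb (reach_sym e_sym (reach_walk (h := g) sj (fun m _ => g_edge m))).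
have [h|h] := leqP (a + (s - U j)) (k + 1); first exact: reach_le r1.
by apply: reach_le r2; rewrite /gap in ab; lia.
Qed.

(** The walks from [vtx i] to the two ends, in opposite directions round the inscribed cycle, use
    together the [l - 1] edges other than the one spanning segment [j]. *)
Lemma small_near_segment i j : (j < l)%N -> (gap j + l <= 2 * k + 4)%N -> near_segment i j.
Proof.
move=> jl gj; have -> : near_segment i j = near_segment (i %% l) j.
  by rewrite /near_segment /vtx modn_mod.
have il : (i %% l < l)%N by rewrite ltn_mod.
move: (i %% l)%N il => {}i il.
have [ij|ji] := leqP i j.
  exists (j - i)%N, (i + l - j.+1)%N; split; [exact: vtx_reach| |lia].
  by rewrite -(vtx_per i); apply: vtx_reachC; lia.
exists (j + l - i)%N, (i - j.+1)%N; split; [|by apply: vtx_reachC; lia|lia].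
by rewrite -(vtx_per j); apply: vtx_reach; lia.
Qed.

(** Each of the other [l - 2] segments has at least one edge. *)
Lemma far_segments i j : (i < j < l)%N -> (gap i + gap j + (l - 2) <= n)%N.
Proof.
move=> ij; rewrite /gap.
have := @segment_gap 0 i ltac:(lia); have := @segment_gap i.+1 j ltac:(lia).
have := @segment_gap j.+1 l ltac:(lia); have := U_lt (j := i) ltac:(lia).
have := U_lt (j := j) ltac:(lia); lia.
Qed.

Lemma three_segments i j m : (i < j)%N -> (j < m < l)%N ->
  (gap i + gap j + gap m + (l - 3) <= n)%N.
Proof.
move=> ij jm; rewrite /gap.
have := @segment_gap 0 i ltac:(lia); have := @segment_gap i.+1 j ltac:(lia).
have := @segment_gap j.+1 m ltac:(lia); have := @segment_gap m.+1 l ltac:(lia).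
have := U_lt (j := i) ltac:(lia).
have := U_lt (j := j) ltac:(lia); have := U_lt (j := m) ltac:(lia); lia.
Qed.

(* A segment is only a problem for centres away from it when its gap exceeds
   [2 * k + 4 - l]; at most two do, and then a centre between them on their
   shorter side is close enough to both. *)
Lemma center_exists : (3 <= l)%N -> (4 * l <= n + 2)%N ->
  (forall j, (j < l)%N -> (gap j <= n./2 + 1)%N) ->
  exists i, forall j, (j < l)%N -> near_segment i j.
Proof.
move=> l3 ln gapn.
pose big j := (2 * k + 4 < gap j + l)%N.
have self i : (i < l)%N -> near_segment i i.
  move=> il; exists 0%N, 1%N; split.
  - exact: reach_refl.
  - exact/reach_edge/vtx_edge.
  - by have := gapn i il; rewrite /k; lia.
have small i j : (j < l)%N -> ~~ big j -> near_segment i j.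
  by move=> jl; rewrite /big -leqNgt => h; exact: small_near_segment.
have [[a [b [ab bl biga bigb]]]|no2] :=
    pselect (exists a b, [/\ (a < b)%N, (b < l)%N, big a & big b]); last first.
  have [[a [al biga]]|no1] := pselect (exists a, (a < l)%N /\ big a).
    exists a => j jl; have [->|ja] := eqVneq j a; first exact: self.
    apply: small => //; apply/negP => bj; apply: no2.
    have [aj|aj] := ltnP a j; first by exists a, j.
    by exists j, a; split => //; lia.
  by exists 0%N => j jl; apply: small => //; apply/negP => bj; apply: no1; exists j.
(* Three big segments and the remaining ones would have at least [6 * k + 12 - 2 * l] edges, more
   than [n] because [4 * l <= n + 2]. *)
have others j : (j < l)%N -> j != a -> j != b -> ~~ big j.
  move=> jl ja jb; apply/negP => bj.
  have [aj|aj] := ltnP a j.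
    have [bj'|bj'] := ltnP b j.
      have := @three_segments a b j ab ltac:(lia); move: biga bigb bj; rewrite /big /k; lia.
    have := @three_segments a j b aj ltac:(lia); move: biga bigb bj; rewrite /big /k; lia.
  have := @three_segments j a b ltac:(lia) ltac:(lia); move: biga bigb bj; rewrite /big /k; lia.
have gab := @far_segments a b ltac:(lia).
have ga := gapn a ltac:(lia); have gb := gapn b bl.
have [le12|lt21] := leqP (b - a.+1) (a + l - b.+1).
  (* The largest shift past segment [a], not beyond [vtx b], with [gap a + 2 * x + 1 <= 2 * k + 3].
     If it stops before [vtx b], the bound for [b] follows from [gab], [2 * (b - a.+1) <= l - 2] and
     [n <= 4 * k + 3]. *)
  pose x := minn (b - a.+1) ((2 * k + 2 - gap a) %/ 2).
  exists (a.+1 + x)%N => j jl.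
  have [->|ja] := eqVneq j a.
    exists (x + 1)%N, x; split.
    - by have := @vtx_reachC (a.+1 + x) a ltac:(lia); apply: reach_le; lia.
    - by have := @vtx_reachC (a.+1 + x) a.+1 ltac:(lia); apply: reach_le; lia.
    - by rewrite /x /k; rewrite /k in ga; lia.
  have [->|jb] := eqVneq j b; last by apply: small => //; exact: others.
  exists (b - (a.+1 + x))%N, (b.+1 - (a.+1 + x))%N; split.
  - by apply: vtx_reach; rewrite /x; lia.
  - by apply: vtx_reach; rewrite /x; lia.
  - by rewrite /x /k; lia.
pose x := minn (a + l - b.+1) ((2 * k + 2 - gap b) %/ 2).
exists (b.+1 + x)%N => j jl.
have [->|jb] := eqVneq j b.
  exists (x + 1)%N, x; split.
  - by have := @vtx_reachC (b.+1 + x) b ltac:(lia); apply: reach_le; lia.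
  - by have := @vtx_reachC (b.+1 + x) b.+1 ltac:(lia); apply: reach_le; lia.
  - by rewrite /x /k; lia.
have [->|ja] := eqVneq j a; last by apply: small => //; exact: others.
exists (a + l - (b.+1 + x))%N, (a.+1 + l - (b.+1 + x))%N; split.
- by rewrite -(vtx_per a); apply: vtx_reach; rewrite /x; lia.
- by rewrite -(vtx_per a.+1); apply: vtx_reach; rewrite /x; lia.
- by rewrite /x /k; lia.
Qed.

Lemma center_reach : (3 <= l)%N -> (4 * l <= n + 2)%N ->
  (forall j, (j < l)%N -> (U j.+1 - U j <= n./2 + 1)%N) ->
  (forall v, exists2 s, (s < n)%N & v = g s) ->
  exists v, forall u, reach e (n %/ 4 + 1) v u.
Proof.
move=> l3 ln gapn surj; have [i near_i] := center_exists l3 ln gapn.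
exists (vtx i) => u; have [s sn ->] := surj u.
have [j jl js] := segment_cover sn.
exact: near_segment_reach (near_i j jl) js.
Qed.

End Center.

Lemma cycle_mkseq (V : eqType) (e : rel V) (h : nat -> V) l :
  (forall j, (j.+1 < l)%N -> e (h j) (h j.+1)) -> ((0 < l)%N -> e (h l.-1) (h 0)) ->
  cycle e (mkseq h l).
Proof.
case: l => // l hj hl; rewrite (cycle_path (h 0)); apply/(pathP (h 0)) => j.
rewrite size_mkseq => jl; rewrite nth_mkseq//.
case: j jl => [_|j jl].
  suff : e (last (h 0) (mkseq h l.+1)) (h 0) by [].
  by rewrite -nth_last size_mkseq nth_mkseq//; exact: hl.
suff : e (nth (h 0) (mkseq h l.+1) j) (h j.+1) by [].
by rewrite nth_mkseq ?hj//; exact: ltnW.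
Qed.

Lemma next_mkseq (V : eqType) (h : nat -> V) l j : uniq (mkseq h l) -> (j < l)%N ->
  next (mkseq h l) (h j) = h (if (j.+1 < l)%N then j.+1 else 0%N).
Proof.
case: l => // l uh jl; have hj : h j = nth (h 0) (mkseq h l.+1) j by rewrite nth_mkseq.
have hin : h j \in mkseq h l.+1 by rewrite hj mem_nth// size_mkseq.
have ind : index (h j) (mkseq h l.+1) = j by rewrite {1}hj index_uniq// size_mkseq.
rewrite next_nth hin.
suff : nth (h 0) (behead (mkseq h l.+1)) (index (h j) (mkseq h l.+1))
  = h (if (j.+1 < l.+1)%N then j.+1 else 0) by [].
rewrite ind nth_behead; case: ltnP => jl'; first by rewrite nth_mkseq.
by rewrite nth_default// size_mkseq.
Qed.

(** * Induced cycles cut off by long chords *)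

Section Radius.
Context {V : finType} (e : rel V).
Hypothesis e_sym : symmetric e.
Hypothesis e_irr : irreflexive e.
Hypothesis induced_short : forall c, graph_cycle e c ->
  (forall u v, u \in c -> v \in c -> e u v -> v = next c u \/ u = next c v) ->
  (4 * size c <= #|V| + 2)%N.

Let n := #|V|.

(** The [n]-periodic extension lets an arc of the cycle start at any vertex without wrapping
    indices. *)
Lemma cyclic_numbering c : graph_cycle e c -> (forall v, v \in c) ->
  exists f : nat -> V, [/\ (3 <= n)%N, forall i, e (f i) (f i.+1), forall i, f (i + n) = f i
    & forall i s t, (s < n)%N -> (t < n)%N -> f (i + s) = f (i + t) -> s = t].
Proof.
move=> [c3 /andP[cc uc]] cV.
have sz : size c = n by rewrite /n -(card_uniqP uc); apply: eq_card => v; rewrite cV.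
case: c => [//|x0 c'] in c3 cc uc cV sz *; set c := x0 :: c' in c3 cc uc cV sz.
have n0 : (0 < n)%N by rewrite -sz.
exists (fun i => nth x0 c (i %% n)); split.
- by rewrite -sz.
- move=> i; move: cc; rewrite (cycle_path x0) => /(pathP x0) h.
  have il : (i %% n < n)%N by rewrite ltn_mod.
  have iS : (i.+1 %% n = (i %% n).+1 %% n)%N by rewrite -addn1 -modnDml addn1.
  have [i1|i1] := ltnP (i %% n).+1 n.
    by rewrite iS [in X in e _ X]modn_small//; apply: (h (i %% n).+1); rewrite sz.
  have iE : (i %% n).+1 = n by apply/eqP; rewrite eqn_leq il.
  have h0 : e (last x0 c) (nth x0 c 0) by apply: (h 0%N).
  have nE : n.-1 = (i %% n)%N by move: iE; case: (n) => // n' [].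
  by rewrite iS iE modnn; move: h0; rewrite -nth_last sz nE.
- by move=> i; rewrite modnDr.
- move=> i s t sn tn /eqP; rewrite nth_uniq ?sz ?ltn_mod// eqn_modDl => /eqP.
  by rewrite !modn_small.
Qed.

(* A shortest increasing path from [0] to [L] avoiding the edge [0 L] closes up,
   with this edge, to an induced cycle: any other chord would be a shortcut. *)
Lemma induced_path (g : nat -> V) L : (2 <= L)%N -> (forall s, e (g s) (g s.+1)) ->
  exists m u, [/\ [/\ (2 <= m)%N, u 0 = 0%N & u m = L],
    forall j, (j < m)%N -> (u j < u j.+1)%N /\ e (g (u j)) (g (u j.+1))
    & forall i j, (i < j <= m)%N -> e (g (u i)) (g (u j)) -> j = i.+1 \/ (i = 0%N /\ j = m)].
Proof.
move=> L2 ge.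
pose Q m (u : nat -> nat) := [/\ (2 <= m)%N, u 0 = 0%N, u m = L
    & forall j, (j < m)%N -> (u j < u j.+1)%N /\ e (g (u j)) (g (u j.+1))].
have : exists m, `[< exists u, Q m u >].
  by exists L; apply/asboolP; exists id; split.
move=> /ex_minnP[m /asboolP[u [m2 u0 um uP]] mmin].
exists m, u; split => // i j /andP[ij jm] eij.
have [->|jN] := eqVneq j i.+1; first by left.
right; apply: contrapT => nij.
have := mmin (m - (j - i.+1))%N.
suff h : exists u', Q (m - (j - i.+1))%N u' by move=> /(_ (asboolT h)); lia.
(* Shifting the indices past [i] replaces the steps from [u i] to [u j] by one edge. At least two
   steps remain because [i = 0], [j = m] is excluded. *)
exists (fun s => if (s <= i)%N then u s else u (s + (j - i.+1))%N); split.
- by apply/negP => /negP; rewrite -ltnNge => h; apply: nij; lia.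
- by rewrite leq0n.
- by rewrite leqNgt; have -> /= : (i < m - (j - i.+1))%N; [lia | rewrite subnK//; lia].
- move=> s sm; have [si|si] := ltnP s i.
    by rewrite (ltnW si); apply: uP; lia.
  have [->|sN] := eqVneq s i.
    rewrite leqnn; have -> : (i.+1 + (j - i.+1) = j)%N by lia.
    split => //; have mono a b : (a < b)%N -> (b <= m)%N -> (u a < u b)%N.
      elim: b => // b IH; rewrite ltnS leq_eqVlt => /predU1P[->|ab] bm; first by have [] := uP b bm.
      by apply: ltn_trans (IH ab (ltnW bm)) _; have [] := uP b bm.
    exact: mono.
  have -> : (s <= i)%N = false by lia.
  by rewrite addSn; apply: uP; lia.
Qed.

(** A chord of least span [L] and a shortest increasing path below it form an induced cycle with
    [m.+1] vertices; minimality bounds the segments it cuts off, so [center_reach] applies. *)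
Lemma hamiltonian_radius c : graph_cycle e c -> (forall v, v \in c) ->
  (graph_radius e <= n %/ 4 + 1)%N.
Proof.
move=> gc cV; have [f [n3 fe fper finj]] := cyclic_numbering gc cV.
(* The alternative [L = n.-1] keeps an edge of the Hamiltonian cycle admissible when [n] is 3 or 4,
   where [n./2 + 1 < n.-1] fails. *)
pose P L := [/\ (2 <= L < n)%N, exists i, e (f i) (f (i + L)) & (n./2 + 1 < L)%N \/ L = n.-1].
have : exists L, `[< P L >].
  exists n.-1; apply/asboolP; split; [lia| |by right].
  by exists 1%N; rewrite add1n prednK; [rewrite -[n]add0n fper e_sym | lia].
move=> /ex_minnP[L /asboolP[/andP[L2 Ln] [i0 iL] Lbig] Lmin].
pose g s := f (i0 + s).
have ge s : e (g s) (g s.+1) by rewrite /g addnS.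
have gn : g n = g 0%N by rewrite /g fper addn0.
have ginj s t : (s < n)%N -> (t < n)%N -> g s = g t -> s = t by exact: finj.
have [m [u [[m2 u0 um] uP uI]]] := induced_path L2 ge.
have mono a b : (a < b)%N -> (b <= m)%N -> (u a < u b)%N.
  elim: b => // b IH; rewrite ltnS leq_eqVlt => /predU1P[->|ab] bm; first by have [] := uP b bm.
  by apply: ltn_trans (IH ab (ltnW bm)) _; have [] := uP b bm.
have uL j : (j <= m)%N -> (u j <= L)%N.
  by rewrite leq_eqVlt => /predU1P[->|jm]; rewrite -um// ltnW// mono.
have eL : e (g L) (g 0%N) by rewrite e_sym /g addn0.
pose h j := g (u j).
have hinj i j : (i <= m)%N -> (j <= m)%N -> h i = h j -> i = j.
  move=> im jm /ginj E; have {}E : u i = u j.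
    by apply: E; apply: (leq_ltn_trans (uL _ _) Ln).
  have [ij|ij|//] := ltngtP i j.
    by have := mono _ _ ij jm; rewrite E ltnn.
  by have := mono _ _ ij im; rewrite E ltnn.
have uh : uniq (mkseq h m.+1).
  by rewrite map_inj_in_uniq ?iota_uniq// => i j; rewrite !mem_iota !add0n /= !ltnS; exact: hinj.
have lm : (4 * m.+1 <= n + 2)%N.
  rewrite -[m.+1](size_mkseq h); apply: induced_short.
    split; first by rewrite size_mkseq.
    apply/andP; split=> //; apply: cycle_mkseq => [j jm|_].
      by have [] := uP j jm.
    by rewrite /= /h um u0.
  have ind i j : (i < j <= m)%N -> e (h i) (h j) ->
      h j = next (mkseq h m.+1) (h i) \/ h i = next (mkseq h m.+1) (h j).
    move=> ij /(uI _ _ ij)[jE|[-> ->]].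
      by left; rewrite next_mkseq// ?jE ?ifT//; lia.
    by right; rewrite next_mkseq ?ltnn.
  move=> _ _ /mapP[i + ->] /mapP[j + ->]; rewrite !mem_iota !add0n /= !ltnS => im jm eij.
  have [ij|ji|ij] := ltngtP i j.
  - by apply: ind; rewrite ?ij.
  - have jim : (j < i <= m)%N by rewrite ji.
    by rewrite e_sym in eij; have [h1|h2] := ind j i jim eij; [right|left].
  - by move: eij; rewrite ij e_irr.
(* The last segment runs from [g L] on to [g n = g 0] and is spanned by the chord itself. *)
pose U j := if (j <= m)%N then u j else n.
have Ug j : (j < m.+1)%N -> (U j < U j.+1)%N /\ e (g (U j)) (g (U j.+1)).
  rewrite ltnS leq_eqVlt => /predU1P[->|jm].
    by rewrite /U leqnn ltnn um gn.
  by rewrite /U jm (ltnW jm); exact: uP.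
have gap j : (j < m.+1)%N -> (U j.+1 - U j <= n./2 + 1)%N.
  rewrite ltnS leq_eqVlt => /predU1P[->|jm].
    by rewrite /U leqnn ltnn um; lia.
  rewrite /U jm (ltnW jm); have [uj ej] := uP j jm.
  have uj1 := uL _ jm.
  rewrite leqNgt; apply/negP => big.
  (* An edge of this span is itself admissible, so by minimality it would reach from [0] to [L],
     against [2 <= m]. *)
  have : (L <= u j.+1 - u j)%N.
    apply: Lmin; apply/asboolP; split; [lia| |by left].
    by exists (i0 + u j)%N; rewrite -addnA subnKC// ltnW.
  have [j0|j0] := posnP j; last by have := mono _ _ j0 (ltnW jm); lia.
  by have := mono j.+1 m ltac:(lia) (leqnn m); lia.
have surj v : exists2 s, (s < n)%N & v = g s.
  have ginj' : injective (fun s : 'I_n => g s).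
    by move=> s t /(ginj _ _ (ltn_ord s) (ltn_ord t)) /val_inj.
  have /codomP[s ->] : v \in codom (fun s : 'I_n => g s).
    by apply: inj_card_onto => //; rewrite card_ord.
  by exists s.
have Ulast : U m.+1 = n by rewrite /U ltnn.
have [v hv] := @center_reach V e e_sym m.+1 n U g isT u0 Ulast (fun j h => (Ug j h).1)
  ge gn (fun j h => (Ug j h).2) m2 lm gap surj.
exact: graph_radius_le hv.
Qed.

End Radius.

Import Order.TTheory GRing.Theory Num.Theory.
Import numFieldNormedType.Exports.
Local Open Scope classical_set_scope.
Local Open Scope ring_scope.

(** * Continuous angles *)

Section Angles.
Context {R : realType}.
Local Notation plane := (R * R)%type.
Implicit Types (v w : plane) (s t : R).

(* [v] is a positive multiple of [(cos t, sin t)], expressed by the signs of the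
   inner and cross products of the two vectors. *)
Definition is_angle v t : Prop :=
  0 < v.1 * cos t + v.2 * sin t /\ v.2 * cos t = v.1 * sin t.

(** With points read as complex numbers, [dotp v w] and [crossp v w] are the real and imaginary
    parts of [cmul (cconj v) w], and [turn v w] is the oriented angle from [v] to [w] when
    [dotp v w] is positive. *)
Definition dotp v w : R := v.1 * w.1 + v.2 * w.2.
Definition crossp v w : R := v.1 * w.2 - v.2 * w.1.
Definition cmul v w : plane := (v.1 * w.1 - v.2 * w.2, v.1 * w.2 + v.2 * w.1).
Definition cconj v : plane := (v.1, - v.2).
Definition turn v w : R := atan (crossp v w / dotp v w).

(** The inner and cross products in [is_angle] are the real and imaginary parts after rotation by
    minus the angle, so they multiply like complex numbers. *)
Lemma is_angleM v w s t :
  is_angle v s -> is_angle w t -> is_angle (cmul v w) (s + t).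
Proof.
move=> [v1 v2] [w1 w2]; rewrite /is_angle cosD sinD /=; split.
  have -> : (v.1 * w.1 - v.2 * w.2) * (cos s * cos t - sin s * sin t) +
     (v.1 * w.2 + v.2 * w.1) * (sin s * cos t + cos s * sin t) =
     (v.1 * cos s + v.2 * sin s) * (w.1 * cos t + w.2 * sin t)
     - (v.2 * cos s - v.1 * sin s) * (w.2 * cos t - w.1 * sin t) by ring.
  by rewrite v2 subrr mul0r subr0 mulr_gt0.
apply/eqP; rewrite -subr_eq0; apply/eqP.
transitivity ((v.1 * cos s + v.2 * sin s) * (w.2 * cos t - w.1 * sin t)
   + (v.2 * cos s - v.1 * sin s) * (w.1 * cos t + w.2 * sin t)); first by ring.
by rewrite v2 w2 !subrr mulr0 mul0r addr0.
Qed.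

Lemma is_angle_conj v t : is_angle v t -> is_angle (cconj v) (- t).
Proof.
by move=> [v1 v2]; rewrite /is_angle/= cosN sinN !(mulrN, mulNr) opprK v2.
Qed.

Lemma is_angleZ v r t : 0 < r -> is_angle (r * v.1, r * v.2) t -> is_angle v t.
Proof.
move=> r0 []; rewrite /is_angle/= -!mulrA -mulrDr pmulr_rgt0// => ? /mulfI-> //.
by rewrite gt_eqF.
Qed.

Lemma is_angle_unit v t : v.1 ^+ 2 + v.2 ^+ 2 = 1 -> is_angle v t ->
  v = (cos t, sin t).
Proof.
move=> vv [v1 v2].
have cs := cos2Dsin2 t.
have e : (v.1 * cos t + v.2 * sin t) ^+ 2 = 1.
  have -> : (v.1 * cos t + v.2 * sin t) ^+ 2 = (v.1 ^+ 2 + v.2 ^+ 2) * (cos t ^+ 2 + sin t ^+2)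
     - (v.2 * cos t - v.1 * sin t) ^+ 2 by ring.
  by rewrite vv cs v2 subrr; ring.
have {}e : v.1 * cos t + v.2 * sin t = 1.
  by move/eqP: e; rewrite sqrf_eq1 => /orP[/eqP//|/eqP E]; move: v1; rewrite E; lra.
have v21 : v.2 = sin t.
  transitivity (v.2 * (cos t ^+ 2 + sin t ^+2)); first by rewrite cs mulr1.
  transitivity ((v.1 * cos t + v.2 * sin t) * sin t); last by rewrite e mul1r.
  rewrite mulrDr mulrDl expr2 mulrA v2; ring.
have v11 : v.1 = cos t.
  transitivity (v.1 * (cos t ^+ 2 + sin t ^+2)); first by rewrite cs mulr1.
  transitivity ((v.1 * cos t + v.2 * sin t) * cos t); last by rewrite e mul1r.
  rewrite mulrDr mulrDl [v.1 * sin t ^+2]mulrA -v2; ring.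
by rewrite -v11 -v21; case: (v).
Qed.

Lemma is_angle_atan v : 0 < v.1 -> is_angle v (atan (v.2 / v.1)).
Proof.
move=> v0; set t := atan _.
have c0 : 0 < cos t by apply: cos_gt0_pihalf; rewrite atan_gtNpi2 atan_ltpi2.
have E : v.2 * cos t = v.1 * sin t.
  have := atanK (v.2 / v.1); rewrite -/t /tan => /eqP.
  by rewrite eqr_div ?lt0r_neq0// => /eqP <-; rewrite mulrC.
split => //.
have E2 : v.2 = v.1 * sin t / cos t by rewrite -E mulfK// gt_eqF.
have -> : v.1 * cos t + v.2 * sin t = v.1 * (cos t ^+2 + sin t ^+ 2) / cos t.
  by rewrite {1}E2; field; rewrite gt_eqF.
by rewrite cos2Dsin2 mulr1 divr_gt0.
Qed.

(** [cmul v (dotp v w, crossp v w)] is [w] times the squared length of [v], and a positive factor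
    does not affect angles. *)
Lemma is_angle_turn v w t : 0 < dotp v w -> is_angle v t -> is_angle w (t + turn v w).
Proof.
move=> d0 vt.
have /(is_angleM vt) : is_angle (dotp v w, crossp v w) (turn v w).
  exact: is_angle_atan.
have r0 : 0 < v.1 ^+ 2 + v.2 ^+ 2.
  rewrite lt0r paddr_eq0 ?sqr_ge0// !sqrf_eq0 addr_ge0 ?sqr_ge0// andbT.
  apply/negP => /andP[/eqP v1 /eqP v2].
  by move: d0; rewrite /dotp v1 v2 !mul0r addr0 ltxx.
move=> H; apply: (is_angleZ r0); move: H; congr (is_angle _ _).
by rewrite /cmul /dotp /crossp /=; congr pair; ring.
Qed.

Lemma is_angle_exists v : v <> 0 -> exists t, is_angle v t.
Proof.
case: v => x y v0.
have [x0|x0|x0] := ltgtP x 0.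
- exists (atan (- y / - x) + pi).
  have [] := @is_angle_atan (- x, - y); first by rewrite /= oppr_gt0.
  by rewrite /is_angle cosDpi sinDpi /= !mulrN !mulNr; split => //; lra.
- by eexists; exact: is_angle_atan.
- have [y0|y0|y0] := ltgtP y 0; last by case: v0; rewrite x0 y0.
  + exists (- (pi / 2)).
    by rewrite /is_angle cosN sinN cos_pihalf sin_pihalf /= x0; split; lra.
  + exists (pi / 2).
    by rewrite /is_angle cos_pihalf sin_pihalf /= x0; split; lra.
Qed.

Lemma is_angle_norm_gt0 v t : is_angle v t -> 0 < v.1 ^+ 2 + v.2 ^+ 2.
Proof.
move=> [h _]; rewrite lt0r addr_ge0 ?sqr_ge0// andbT paddr_eq0 ?sqr_ge0// !sqrf_eq0.
by apply/negP => /andP[/eqP v1 /eqP v2]; move: h; rewrite v1 v2 !mul0r addr0 ltxx.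
Qed.

(** Multiply [v] by its conjugate. The angles of [(1, 0)] are the multiples of 2 pi; this is how
    differences of angles are expressed below. *)
Lemma is_angle_sub v s t : is_angle v s -> is_angle v t -> is_angle (1, 0) (s - t).
Proof.
move=> vs vt; apply: (is_angleZ (is_angle_norm_gt0 vs)).
have := is_angleM vs (is_angle_conj vt).
by congr (is_angle _ _); rewrite /cmul/=; congr pair; ring.
Qed.

Lemma is_angle_shift v t c : is_angle v t -> is_angle (1, 0) c -> is_angle v (t + c).
Proof.
move=> vt /(is_angleM vt); congr (is_angle _ _).
by case: v vt => x y _; rewrite /cmul/=; congr pair; ring.
Qed.

(** An angle of [(1, 0)] is a zero of the sine, which has none strictly between 0 and pi. *)
Lemma is_angle_eq v s t : is_angle v s -> is_angle v t ->
  `|s - t| < pi -> s = t.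
Proof.
move=> vs /(is_angle_sub vs) []; rewrite /= !mul0r mul1r addr0 => c0 /esym; rewrite mul1r => s0.
rewrite ltr_norml => /andP[h1 h2].
apply/eqP; rewrite -subr_eq0; have [d0|d0|//] := ltgtP (s - t) 0.
- have : 0 < sin (- (s - t)) by apply: sin_gt0_pi; rewrite oppr_gt0 d0 ltrNl.
  by rewrite sinN s0 oppr0 ltxx.
- have : 0 < sin (s - t) by apply: sin_gt0_pi; rewrite d0.
  by rewrite s0 ltxx.
Qed.

End Angles.

(** * Continuous branches of the angle *)

Section HasAngle.
Context {R : realType}.
Local Notation plane := (R * R)%type.

Lemma connected_locally_constant (T : topologicalType) (A : set T) (P : T -> Prop) :
  connected A ->
  (forall x, A x -> \forall y \near within A (nbhs x), P y <-> P x) ->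
  forall x y, A x -> A y -> P x -> P y.
Proof.
move=> cA loc x y Ax Ay Px.
(* [C1] and [C2] are open in the whole space and meet [A] exactly where [P] holds, respectively
   fails, so that [P] cuts out a relatively clopen part. *)
pose C1 := interior [set z | A z -> P z]; pose C2 := interior [set z | A z -> ~ P z].
have C1P z : A z -> P z -> C1 z.
  move=> Az Pz; have h : nbhs z [set w | A w -> (P w <-> P z)] := loc z Az.
  by apply: (filterS _ h) => w {}h /h[_]; apply.
have C2P z : A z -> ~ P z -> C2 z.
  move=> Az Pz; have h : nbhs z [set w | A w -> (P w <-> P z)] := loc z Az.
  by apply: (filterS _ h) => w {}h /h[hh _] /hh.
have : A `&` C1 = A.
  apply: cA; first by exists x; split => //; exact: C1P.
    by exists C1 => //; exact: open_interior.
  exists (~` C2); first by apply: open_closedC; exact: open_interior.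
  apply/seteqP; split=> z [Az zC]; split => //.
    by move=> /interior_subset/(_ Az); apply; exact: (interior_subset zC).
  by apply: C1P => //; apply: contrapT => /(C2P _ Az).
move=> E; have [_ /interior_subset] : (A `&` C1) y by rewrite E.
exact.
Qed.

Lemma within_comp (T U V : topologicalType) (A : set U) (B : set T)
    (f : U -> V) (g : T -> U) :
  {within A, continuous f} -> {within B, continuous g} ->
  (forall x, B x -> A (g x)) -> {within B, continuous (f \o g)}.
Proof.
move=> /subspace_continuousP cf /subspace_continuousP cg BA.
apply/subspace_continuousP => x Bx O /= Of.
have h : nbhs x [set y | B y -> A (g y) -> O (f (g y))].
  exact: cg x Bx _ (cf (g x) (BA x Bx) O Of).
suff : nbhs x [set y | B y -> O (f (g y))] by [].
by apply: filterS h => y hy By; apply: hy => //; exact: BA.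
Qed.

Lemma within_setT_continuous (T U : topologicalType) (f : T -> U) :
  {within setT, continuous f} -> continuous f.
Proof.
move=> /subspace_continuousP cf x O Of.
have h : nbhs x [set y | setT y -> O (f y)] := cf x I O Of.
suff : nbhs x [set y | O (f y)] by [].
by apply: filterS h => y; apply.
Qed.

Lemma open_within_continuous (T U : topologicalType) (A : set T) (f : T -> U) x :
  open A -> A x -> {within A, continuous f} -> {for x, continuous f}.
Proof.
move=> oA Ax /subspace_continuousP cf O Of.
have h : nbhs x [set y | A y -> O (f y)] := cf x Ax O Of.
suff : nbhs x [set y | O (f y)] by [].
by apply: filterS2 h (open_nbhs_nbhs (conj oA Ax)) => y; apply.
Qed.

(** A continuous branch of the argument of [h] along [A]; it forces [h] to be nonzero there. *)
Definition has_angle (T : topologicalType) (A : set T) (h : T -> plane) : Prop :=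
  exists2 t : T -> R, {within A, continuous t}
    & forall z, A z -> is_angle (h z) (t z).

Lemma has_angle_subset (T : topologicalType) (A B : set T) h :
  A `<=` B -> has_angle B h -> has_angle A h.
Proof.
move=> AB [t ct th]; exists t; last by move=> z /AB/th.
exact: continuous_subspaceW ct.
Qed.

Section CvgPlane.
Context (T : Type) (F : set_system T) {FF : Filter F}.
Implicit Types (f g : T -> plane) (a b : plane).

Lemma cvg_pr1 f a : f @ F --> a -> (fun z => (f z).1) @ F --> a.1.
Proof. by move=> fa; apply: cvg_comp fa _; exact: cvg_fst. Qed.

Lemma cvg_pr2 f a : f @ F --> a -> (fun z => (f z).2) @ F --> a.2.
Proof. by move=> fa; apply: cvg_comp fa _; exact: cvg_snd. Qed.

Lemma cvg_dotp f g a b : f @ F --> a -> g @ F --> b ->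
  (fun z => dotp (f z) (g z)) @ F --> dotp a b.
Proof.
by move=> fa gb; apply: cvgD; apply: cvgM; (exact: cvg_pr1 || exact: cvg_pr2).
Qed.

Lemma cvg_turn f g a b : 0 < dotp a b -> f @ F --> a -> g @ F --> b ->
  (fun z => turn (f z) (g z)) @ F --> turn a b.
Proof.
move=> d0 fa gb; apply: (@cvg_comp _ _ _ _ atan); last exact: continuous_atan.
apply: cvgM; last by apply: cvgV; [rewrite gt_eqF | exact: cvg_dotp].
by apply: cvgB; apply: cvgM; (exact: cvg_pr1 || exact: cvg_pr2).
Qed.

End CvgPlane.

(** The directions of [f] and [g] differ by less than a right angle, so adding [turn] to a branch
    for [f] gives one for [g]. *)
Lemma has_angle_turn (T : topologicalType) (A : set T) (f g : T -> plane) :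
  {within A, continuous f} -> {within A, continuous g} ->
  (forall z, A z -> 0 < dotp (f z) (g z)) -> has_angle A f -> has_angle A g.
Proof.
move=> /subspace_continuousP cf /subspace_continuousP cg d [t ct th].
exists (fun z => t z + turn (f z) (g z)); last first.
  by move=> z Az; apply: is_angle_turn; [exact: d | exact: th].
move/subspace_continuousP : ct => ct.
apply/subspace_continuousP => x Ax; apply: cvgD; first exact: ct.
by apply: cvg_turn; [exact: d | exact: cf | exact: cg].
Qed.

Lemma has_angleM (T : topologicalType) (A : set T) (f g : T -> plane) :
  has_angle A f -> has_angle A g -> has_angle A (fun z => cmul (f z) (g z)).
Proof.
move=> [s /subspace_continuousP cs sf] [t /subspace_continuousP ct tg].
exists (fun z => s z + t z); last by move=> z Az; apply: is_angleM; [exact: sf| exact: tg].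
by apply/subspace_continuousP => x Ax; apply: cvgD; [exact: cs|exact: ct].
Qed.

Lemma has_angle_conj (T : topologicalType) (A : set T) (f : T -> plane) :
  has_angle A f -> has_angle A (fun z => cconj (f z)).
Proof.
move=> [s /subspace_continuousP cs sf].
exists (fun z => - s z); last by move=> z Az; apply: is_angle_conj; exact: sf.
by apply/subspace_continuousP => x Ax; apply: cvgN; exact: cs.
Qed.

(** The difference is continuous and takes values in the angles of [(1, 0)], which are discrete by
    [is_angle_eq]. *)
Lemma angle_diff_const (T : topologicalType) (A : set T) (h : T -> plane) (s t : T -> R) :
  connected A -> {within A, continuous s} -> {within A, continuous t} ->
  (forall z, A z -> is_angle (h z) (s z)) -> (forall z, A z -> is_angle (h z) (t z)) ->
  forall x y, A x -> A y -> s x - t x = s y - t y.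
Proof.
move=> cA /subspace_continuousP cs /subspace_continuousP ct sh th x y Ax Ay.
apply/esym; apply: (connected_locally_constant (P := fun z => s z - t z = s x - t x) cA _ Ax Ay) => //.
move=> {Ay}y Ay; pose d z := s z - t z.
have : d @ within A (nbhs y) --> d y by apply: cvgB; [exact: cs|exact: ct].
move=> /cvgrPdist_lt/(_ pi (pi_gt0 _)) dy.
suff : \forall z \near within A (nbhs y), d z = d y.
  by apply: filterS => z; rewrite /d => ->.
have : \forall z \near within A (nbhs y), A z by apply: withinT; exact: nbhs_filter.
apply: filterS2 dy => z dz Az.
have e1 w : A w -> is_angle (1, 0) (d w).
  by move=> Aw; exact: is_angle_sub (sh _ Aw) (th _ Aw).
by apply/esym; apply: is_angle_eq (e1 _ Ay) (e1 _ Az) _.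
Qed.

End HasAngle.

(** * Gluing and lifting of angles *)

Section Lifting.
Context {R : realType}.
Local Notation plane := (R * R)%type.
Local Notation I01 := (`[0%R, 1%R]%classic : set R).

(** On the connected overlap the two branches differ by a constant angle of [(1, 0)]; adding it to
    the second makes them agree. For an empty overlap the constant 0 serves. *)
Lemma angle_patch (T : topologicalType) (A B : set T) (h : T -> plane) :
  connected (A `&` B) -> has_angle A h -> has_angle B h ->
  exists t : T -> R, [/\ {within A, continuous t}, {within B, continuous t}
    & forall z, (A `|` B) z -> is_angle (h z) (t z)].
Proof.
move=> cAB [s cs sh] [t ct th].
have [c c1 cE] : exists2 c, is_angle (1, 0) c & forall z, A z -> B z -> s z = t z + c.
  have [[x [Ax Bx]]|AB0] := pselect (A `&` B !=set0); last first.
    exists 0; first by rewrite /is_angle cos0 sin0 /=; split; lra.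
    by move=> z Az Bz; case: AB0; exists z.
  exists (s x - t x); first by apply: is_angle_sub (th _ Bx); exact: sh.
  move=> z Az Bz; rewrite (angle_diff_const cAB _ _ (h := h) _ _ (y := z))//.
  - by rewrite addrC subrK.
  - exact: continuous_subspaceW cs.
  - exact: continuous_subspaceW ct.
  - by move=> w [/sh].
  - by move=> w [_ /th].
have thc z : B z -> is_angle (h z) (t z + c).
  by move=> Bz; apply: is_angle_shift => //; exact: th.
exists (fun z => if z \in A then s z else t z + c); split; last first.
- move=> z ABz; have [/set_mem /sh //|zA] := boolP (z \in A).
  by apply: thc; case: ABz => // /mem_set; rewrite (negPf zA).
- have : {within B, continuous (fun z => t z + c)}.
    move/subspace_continuousP : ct => ct; apply/subspace_continuousP => x Bx.
    by apply: cvgD; [exact: ct | exact: cvg_cst].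
  apply: subspace_eq_continuous => z /set_mem zB; rewrite /from_subspace.
  by have [/set_mem zA|//] := boolP (z \in A); rewrite (cE _ zA zB).
- by apply: subspace_eq_continuous cs => z zA; rewrite /from_subspace zA.
Qed.

Lemma has_angle_glue (T : topologicalType) (A B : set T) (h : T -> plane) :
  closed A -> closed B -> connected (A `&` B) ->
  has_angle A h -> has_angle B h -> has_angle (A `|` B) h.
Proof.
move=> clA clB cAB hA hB; have [t [tA tB th]] := angle_patch cAB hA hB.
by exists t => //; exact: withinU_continuous.
Qed.

Lemma has_angle_glue_open (T : topologicalType) (A B : set T) (h : T -> plane) :
  open A -> open B -> connected (A `&` B) ->
  has_angle A h -> has_angle B h -> has_angle (A `|` B) h.
Proof.
move=> oA oB cAB hA hB; have [t [tA tB th]] := angle_patch cAB hA hB.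
exists t => //; apply/subspace_continuousP => x ABx; apply: cvg_within_filter.
by case: ABx => [Ax|Bx]; [exact: (open_within_continuous oA)|exact: (open_within_continuous oB)].
Qed.

Lemma dotp_near (v : plane) : v <> 0 ->
  exists2 U, nbhs v U & forall a b, U a -> U b -> 0 < dotp a b.
Proof.
move=> v0.
have d0 : 0 < dotp v v.
  rewrite /dotp -!expr2 lt0r addr_ge0 ?sqr_ge0// andbT paddr_eq0 ?sqr_ge0// !sqrf_eq0.
  by apply/negP => /andP[/eqP v1 /eqP v2]; apply: v0; move: v1 v2; case: (v) => /= ? ? -> ->.
have cd : (fun p : plane * plane => dotp p.1 p.2) @ (v, v) --> dotp v v.
  by apply: cvg_dotp; [exact: cvg_fst | exact: cvg_snd].
have := cvgr_gt (dotp v v) cd _ d0; case=> [[U V] /= [Uv Vv] UV].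
exists (U `&` V); first exact: filterI.
by move=> a b [Ua _] [_ Vb]; apply: (UV (a, b)).
Qed.

(** Homotopy lifting: at parameter 0 a constant angle serves, and short parameter steps turn every
    vector by less than a right angle, so [has_angle_turn] carries the angle to parameter 1. *)
Lemma lift_homotopy (T : topologicalType) (K : set T) (F : T -> R -> plane) :
  compact K -> continuous (fun p : T * R => F p.1 p.2) ->
  (forall z (s : R), K z -> 0 <= s <= 1 -> F z s <> 0) ->
  (forall z w, K z -> K w -> F z 0 = F w 0) ->
  has_angle K (F^~ 1).
Proof.
move=> cK cF F0 Fc.
have cFs s : continuous (F^~ s).
  by move=> z; apply: (@continuous2_cvg _ _ _ _ _ _ _ _ F); [exact: (cF (z, s)) | exact: cvg_id | exact: cvg_cst].
have cKI : compact (K `*` I01) by apply: compact_setX => //; exact: segment_compact.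
(* Compactness of [K] times the unit interval gives one step length for all points. *)
have [N NP] : exists N : nat, forall z (s s' : R), K z -> 0 <= s <= 1 ->
    `|s - s'| <= N.+1%:R^-1 -> 0 < dotp (F z s) (F z s').
  have /compact_near_coveringP := cKI.
  pose P n (p : T * R) := forall s', `|p.2 - s'| <= n.+1%:R^-1 -> 0 < dotp (F p.1 p.2) (F p.1 s').
  move=> /(_ nat \oo P _)[].
    move=> [z s] [/= Kz]; rewrite in_itv/= => s01.
    have [U Uv UU] := dotp_near (F0 z s Kz s01).
    have [[V W] /= [Vz /nbhs_ballP[e /= e0 We]] VW] := cF (z, s) U Uv.
    exists (V `*` ball s (e / 2), [set n | n.+1%:R^-1 < e / 2]) => /=.
      split; first by exists (V, ball s (e / 2)) => //=; split => //; apply: nbhsx_ballx; rewrite divr_gt0.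
      exact: near_infty_natSinv_lt (PosNum (divr_gt0 e0 (ltr0Sn R 1))).
    move=> [[z' s'] n] /= [[Vz' s's] nn] s'' /= h.
    apply: UU; apply: (VW (_, _)); split => //=; apply: We.
      by apply: le_ball s's; lra.
    have : `|s - s''| < e; last by [].
    rewrite (le_lt_trans (ler_distD s' _ _))// [e]splitr ltrD//.
    exact: le_lt_trans h _.
  move=> N _ /(_ N (leqnn _)) h; exists N => z s s' Kz s01.
  by apply: (h (z, s)); split => //=; rewrite in_itv.
have H k : (k <= N.+1)%N -> has_angle K (F^~ (k%:R / N.+1%:R)).
  elim: k => [_|k IH kN].
    rewrite mul0r; have [->|/set0P[z Kz]] := eqVneq K set0.
      by exists (fun=> 0) => //; apply: continuous_subspaceT; exact: cst_continuous.
    have [t tP] := is_angle_exists (F0 z 0 Kz ltac:(lra)).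
    exists (fun=> t); first by apply: continuous_subspaceT; exact: cst_continuous.
    by move=> w Kw; rewrite (Fc _ _ Kw Kz).
  apply: has_angle_turn (IH (ltnW kN)); try exact: continuous_subspaceT.
  have N0 : 0 < N.+1%:R :> R by [].
  move=> z Kz; apply: NP => //.
    by rewrite divr_ge0//= ler_pdivrMr// mul1r ler_nat ltnW.
  by rewrite -mulrBl normrM -natr1 opprD addrA subrr add0r normrN1 mul1r ger0_norm.
by have := H N.+1 (leqnn _); rewrite divff.
Qed.

(** The path is contracted along itself to the constant [h 0]. *)
Lemma has_angle_path (h : R -> plane) : continuous h ->
  (forall s : R, 0 <= s <= 1 -> h s <> 0) -> has_angle I01 h.
Proof.
move=> ch h0.
have := @lift_homotopy _ I01 (fun t s => h (t * s)) (@segment_compact _ _ _).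
rewrite [X in has_angle _ X](_ : _ = h); last by apply/funext => s; rewrite mulr1.
apply.
- move=> p; have cp : (fun p : R * R => p.1 * p.2) @ p --> p.1 * p.2.
    by apply: cvgM; [exact: cvg_fst | exact: cvg_snd].
  exact: cvg_comp cp (ch _).
- by move=> z s /=; rewrite in_itv/= => /andP[z0 z1] /andP[s0 s1]; apply: h0; rewrite mulr_ge0//= mulr_ile1.
- by move=> z w _ _; rewrite !mulr0.
Qed.

Lemma plane_hausdorff : hausdorff_space plane.
Proof. exact: norm_hausdorff. Qed.

(** A continuous injection of a compact set into a Hausdorff space is a homeomorphism onto its
    image, so the angle transfers through the inverse. *)
Lemma has_angle_image (K : set R) (g : R -> plane) (h : plane -> plane) :
  compact K -> {within K, continuous g} -> {in K &, injective g} ->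
  has_angle K (h \o g) -> has_angle (g @` K) h.
Proof.
move=> cK cg ig [t ct th].
pose inv z := xget 0 [set s | K s /\ g s = z].
have invP s : K s -> inv (g s) = s.
  move=> Ks; rewrite /inv; case: xgetP => [r -> [Kr gr]|/(_ s)]; last by case; split.
  by apply: ig => //; exact: mem_set.
exists (t \o inv); last by move=> _ [s Ks <-] /=; rewrite invP//; exact: th.
apply/subspace_continuousP => _ [s Ks <-] /=.
rewrite /from_subspace /= invP//.
move=> O /= /nbhs_interior; set O' := interior O => sO.
have : closed (t @^-1` (~` O') : set (subspace K)).
  by apply: closed_comp => [? _|]; [exact: ct | apply: open_closedC; exact: open_interior].
move=> /closed_subspaceP[V clV VE].
have cVK : compact (V `&` K) by rewrite setIC; exact: compact_closedI.
have clg : closed (g @` (V `&` K)).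
  apply: compact_closed; first exact: plane_hausdorff.
  apply: continuous_compact cVK.
  by apply: continuous_subspaceW cg => ? [].
rewrite VE in clg.
have : nbhs (g s) (~` (g @` ((t @^-1` (~` O')) `&` K))).
  apply: open_nbhs_nbhs; split; first exact: closed_openC.
  move=> [r [rO Kr] /ig]; rewrite !inE => /(_ Kr Ks) rs; apply: rO; rewrite rs.
  exact: nbhs_singleton.
rewrite /within /= nbhs_filterE => N.
apply: filterS N => z zn [r Kr rz] /=; rewrite -rz invP//.
apply: interior_subset; apply: contrapT => rO; apply: zn; exists r => //.
Qed.

End Lifting.

(** * Separation of the plane *)

Section PlaneBasics.
Context {R : realType}.
Local Notation plane := (R * R)%type.
Implicit Types (v p q a b z : plane).

Lemma norm_ltP v e : `|v| < e <-> `|v.1| < e /\ `|v.2| < e.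
Proof. by rewrite prod_normE gt_max; split => /andP. Qed.

Lemma norm_leP v e : `|v| <= e <-> `|v.1| <= e /\ `|v.2| <= e.
Proof. by rewrite prod_normE ge_max; split => /andP. Qed.

Lemma norm_pr1 v : `|v.1| <= `|v|.
Proof. by have [] := (norm_leP v `|v|).1 (lexx _). Qed.

Lemma norm_pr2 v : `|v.2| <= `|v|.
Proof. by have [] := (norm_leP v `|v|).1 (lexx _). Qed.

Lemma ball_planeE p e : ball p e = [set z | `|p - z| < e].
Proof. by rewrite prod_norm_ball. Qed.

Lemma bounded_setP (A : set plane) :
  bounded_set A <-> exists M, forall x, A x -> `|x| <= M.
Proof.
split=> [|[M hM]].
  rewrite /= /bounded_near => /filter_ex[M hM]; exists M => x Ax.
  exact: hM.
rewrite /= /bounded_near; near=> M' => x Ax /=.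
apply: (le_trans (hM _ Ax)); near: M'; apply: nbhs_pinfty_ge; exact: num_real.
Unshelve. all: by end_near. Qed.

Lemma cvg_mkpair (T : Type) (F : set_system T) {FF : Filter F} (f g : T -> R) (a b : R) :
  f @ F --> a -> g @ F --> b -> (fun t => (f t, g t)) @ F --> (a, b).
Proof.
by move=> fa gb; exact: (@cvg_pair _ _ _ F (nbhs a) (nbhs b) _ _ _ f g fa gb).
Qed.

Lemma star_connected (A : set plane) a : A a ->
  (forall z (s : R), A z -> 0 <= s <= 1 -> A (a + s *: (z - a))) -> connected A.
Proof.
move=> Aa As.
have -> : A = \bigcup_(z in A) ((fun s => a + s *: (z - a)) @` (`[0, 1]%classic : set R)).
  apply/seteqP; split=> [z Az|y [z Az [s]]].
    exists z => //; exists 1; last by rewrite scale1r addrC subrK.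
    by rewrite /= in_itv/= ler01 lexx.
  by rewrite /= in_itv/= => s01 <-; exact: As.
apply: bigcup_connected.
  by exists a => z Az; exists 0; rewrite ?scale0r ?addr0//= in_itv/= lexx ler01.
move=> z Az; apply: connected_continuous_connected; first exact: segment_connected.
apply: continuous_subspaceT => s.
apply: cvgD; first exact: cvg_cst.
by apply: cvgZ; [exact: cvg_id|exact: cvg_cst].
Qed.

Lemma ball_connected p e : connected (ball p e).
Proof.
have [e0|e0] := ltP 0 e; last first.
  suff -> : ball p e = set0 by exact: connected0.
  by apply/seteqP; split=> z //; rewrite ball_planeE/= => /lt_le_trans/(_ e0); rewrite normr_lt0.
apply: (@star_connected _ p); first exact: ballxx.
move=> z s; rewrite ball_planeE/= => pz /andP[s0 s1].
rewrite opprD addrA subrr add0r normrN normrZ distrC ger0_norm//.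
by rewrite (le_lt_trans _ pz)// ler_piMl.
Qed.

(** For the max norm this is a union of four convex half-planes, each meeting the union of the
    previous ones. *)
Lemma exterior_connected M : connected [set z : plane | M < `|z|].
Proof.
have cvx x y s : M < x -> M < y -> 0 <= s <= 1 -> M < x + s * (y - x).
  move=> Mx My /andP[s0 s1]; have [->|sN] := eqVneq s 0; first lra.
  have h1 : 0 < s * (y - M) by rewrite mulr_gt0 ?subr_gt0// lt_neqAle eq_sym sN.
  have h2 : 0 <= (1 - s) * (x - M) by rewrite mulr_ge0 ?subr_ge0// ltW.
  by rewrite -subr_gt0 (_ : _ - M = (1 - s) * (x - M) + s * (y - M)) ?ltr_wpDl//; ring.
have cH1 : connected [set z : plane | M < z.1].
  apply: (@star_connected _ (M + 1, 0)); first by rewrite /=; lra.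
  by move=> z s /= zM s01; apply: cvx => //; lra.
have cH2 : connected [set z : plane | M < z.2].
  apply: (@star_connected _ (0, M + 1)); first by rewrite /=; lra.
  by move=> z s /= zM s01; apply: cvx => //; lra.
have cH3 : connected [set z : plane | M < - z.1].
  apply: (@star_connected _ (- (M + 1), 0)); first by rewrite /=; lra.
  move=> z s zM s01; have M1 : M < M + 1 by lra.
  have := cvx (M + 1) (- z.1) s M1 zM s01; congr (_ < _).
  rewrite -[RHS]/(- (- (M + 1) + s * (z.1 - - (M + 1)))); ring.
have cH4 : connected [set z : plane | M < - z.2].
  apply: (@star_connected _ (0, - (M + 1))); first by rewrite /=; lra.
  move=> z s zM s01; have M1 : M < M + 1 by lra.
  have := cvx (M + 1) (- z.2) s M1 zM s01; congr (_ < _).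
  rewrite -[RHS]/(- (- (M + 1) + s * (z.2 - - (M + 1)))); ring.
have -> : [set z : plane | M < `|z|] = [set z : plane | M < z.1] `|` [set z : plane | M < z.2]
   `|` [set z : plane | M < - z.1] `|` [set z : plane | M < - z.2].
  apply/seteqP; split=> z /=.
    rewrite prod_normE lt_max !real_lter_normr ?num_real//.
    by move=> /orP[/orP[]|/orP[]] ?; tauto.
  rewrite prod_normE lt_max !real_lter_normr ?num_real//.
  by move=> [[[]|]|] ->; rewrite ?orbT.
apply: connectedU => //; last apply: connectedU => //; last apply: connectedU => //.
- exists (M + 1, - (M + 1)) => /=; split; [left; left|]; lra.
- exists (- (M + 1), (M + 1)) => /=; split; [right|]; lra.
- exists ((M + 1), (M + 1)) => /=; split; lra.
Qed.

Lemma component_ball (C : set plane) a p e :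
  ball p e `<=` ~` C -> ball p e `&` connected_component (~` C) a !=set0 ->
  ball p e `<=` connected_component (~` C) a.
Proof.
move=> bC [z [bz az]].
rewrite (same_connected_component az).
apply: connected_component_max => //; exact: ball_connected.
Qed.

Lemma component_open (C : set plane) a : closed C -> open (connected_component (~` C) a).
Proof.
move=> clC; rewrite openE => z az.
have /nbhs_ballP[e /= e0 be] : nbhs z (~` C).
  apply: open_nbhs_nbhs; split; first exact: closed_openC.
  exact: connected_component_sub az.
apply/nbhs_ballP; exists e => //; apply: component_ball be _.
by exists z; split => //; exact: ballxx.
Qed.

(** A ball around a frontier point off [C] is connected and meets the component, hence would lie in
    it. *)
Lemma component_frontier (C : set plane) a : closed C ->
  closure (connected_component (~` C) a) `\` connected_component (~` C) a `<=` C.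
Proof.
move=> clC z [zcl zn]; apply: contrapT => zC; apply: zn.
have /nbhs_ballP[e /= e0 be] : nbhs z (~` C).
  by apply: open_nbhs_nbhs; split => //; exact: closed_openC.
apply: (component_ball be); last exact: ballxx.
by have := zcl _ (nbhsx_ballx z e e0); rewrite setIC.
Qed.

End PlaneBasics.

(** * Angles seen from a point of the plane *)

Section Winding.
Context {R : realType}.
Local Notation plane := (R * R)%type.
Implicit Types (v p q a b z : plane) (K U : set plane).

Definition has_arg a K := has_angle K (fun z => z - a).

Definition circle p (r : R) : set plane :=
  (fun t => (p.1 + r * cos t, p.2 + r * sin t)) @` `[0, pi *+ 2]%classic.

Lemma continuous_subr p : continuous (fun z => z - p).
Proof. by move=> z; apply: cvgB; [exact: cvg_id|exact: cvg_cst]. Qed.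

Lemma circle_continuous p r :
  continuous (fun t => (p.1 + r * cos t, p.2 + r * sin t)).
Proof.
move=> t; apply: cvg_mkpair; (apply: cvgD; first exact: cvg_cst);
  (apply: cvgM; first exact: cvg_cst); [exact: continuous_cos|exact: continuous_sin].
Qed.

(** Along the parametrization the identity is another angle, so the two differ by a constant; but
    the identity grows by 2 pi while the other returns to its value. *)
Lemma no_angle_circle p r : 0 < r -> ~ has_arg p (circle p r).
Proof.
move=> r0 [t ct th].
pose c s : plane := (p.1 + r * cos s, p.2 + r * sin s).
have cc : {within `[0, pi *+ 2], continuous (t \o c)}.
  apply: (within_comp ct); last by move=> x xI; exists x.
  by apply: continuous_subspaceT; exact: circle_continuous.
have p0 := @pi_gt0 R.
have I0 : `[0, pi *+ 2]%classic (0 : R) by rewrite /= in_itv/= lexx mulrn_wge0// ltW.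
have I1 : `[0, pi *+ 2]%classic (pi *+ 2 : R) by rewrite /= in_itv/= lexx mulrn_wge0// ltW.
have := @angle_diff_const R _ _ (fun s => c s - p) (t \o c) id (@segment_connected R 0 (pi *+ 2)) cc _ _ _ _ _ I0 I1.
rewrite /= /c cos0 sin0 cos2pi sin2pi subr0.
move=> H; have : t (p.1 + r * 1, p.2 + r * 0) = t (p.1 + r * 1, p.2 + r * 0) - pi *+ 2.
  apply: H.
  - by apply: continuous_subspaceT => x; exact: cvg_id.
  - by move=> s sI; apply: th; exists s.
  - move=> s _; rewrite /is_angle.
    have -> : (c s - p).1 = r * cos s by rewrite /c /=; ring.
    have -> : (c s - p).2 = r * sin s by rewrite /c /=; ring.
    split; last by ring.
    by rewrite -!mulrA -mulrDr -!expr2 cos2Dsin2 mulr1.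
rewrite mulr2n; lra.
Qed.

Lemma circle_compact p r : compact (circle p r).
Proof.
apply: continuous_compact; last exact: segment_compact.
by apply: continuous_subspaceT; exact: circle_continuous.
Qed.

(* If [z - a] had a continuous angle on [K], Tietze would extend it across [U]
   and produce a nowhere zero field on the plane equal to [(z - a) / |z - a|]
   outside [U]; contracting a large circle then gives that circle an angle. *)
Lemma no_arg_bounded U K a : open U -> bounded_set U -> compact K ->
  closure U `\` U `<=` K -> U a -> ~ has_arg a K.
Proof.
move=> oU /bounded_setP[M hM] cK fU Ua [t ct th].
have [M' M'0 hM'] : exists2 M', 0 < M' & forall z, K z -> `|t z| <= M'.
  have /compact_bounded := continuous_compact ct cK.
  rewrite /= /bounded_near => /filter_ex[M' hM']; exists (`|M'| + 1); first by rewrite ltr_wpDl.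
  move=> z Kz; have /= := hM' (t z) (ex_intro2 _ _ z Kz erefl).
  by move=> /le_trans; apply; rewrite (le_trans (ler_norm _))// lerDl.
have clK : closed K by apply: compact_closed cK; exact: plane_hausdorff.
have [T [tT cT _]] := @continuous_bounded_extension plane R (@pseudometric_normal _ plane) K clK t M' M'0 ct hM'.
pose rho z := Num.sqrt ((z - a).1 ^+ 2 + (z - a).2 ^+ 2).
have rho0 z : z <> a -> 0 < rho z.
  move=> za; rewrite sqrtr_gt0 lt0r addr_ge0 ?sqr_ge0// andbT paddr_eq0 ?sqr_ge0// !sqrf_eq0.
  apply/negP => /andP[/eqP e1 /eqP e2]; apply: za; apply/eqP; rewrite -subr_eq0.
  by case: (z - a) e1 e2 => /= ? ? -> ->.
have rho2 z : rho z ^+ 2 = (z - a).1 ^+ 2 + (z - a).2 ^+ 2.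
  by rewrite sqr_sqrtr// addr_ge0 ?sqr_ge0.
have crho : continuous rho.
  move=> z; apply: (@cvg_comp _ _ _ _ Num.sqrt); last exact: sqrt_continuous.
  have h := @continuous_subr a z.
  by apply: cvgD; apply: cvgM; (exact: (cvg_pr1 h)||exact: (cvg_pr2 h)).
pose u z : plane := ((rho z)^-1 * (z - a).1, (rho z)^-1 * (z - a).2).
have u1 z : z <> a -> (u z).1 ^+ 2 + (u z).2 ^+ 2 = 1.
  move=> za; rewrite /u/= !exprMn -mulrDr -rho2 exprVn mulVf//.
  by rewrite expf_neq0// gt_eqF// rho0.
pose E z : plane := (cos (T z), sin (T z)).
(* The two formulas agree on the frontier of [U]: it lies in [K], where [T] equals the angle [t] of
   [z - a]. *)
pose H z := if z \in U then E z else u z.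
have cH : continuous H.
  apply: within_setT_continuous.
  have -> : setT = closure U `|` ~` U.
    apply/seteqP; split=> z // _; have [zU|] := pselect (U z); last by right.
    by left; exact: subset_closure.
  apply: withinU_continuous; first exact: closed_closure.
  - exact: open_closedC.
  - have : {within closure U, continuous E}.
      apply: continuous_subspaceT => z; apply: cvg_mkpair.
        by apply: (@cvg_comp _ _ _ T); [exact: cT|exact: continuous_cos].
      by apply: (@cvg_comp _ _ _ T); [exact: cT|exact: continuous_sin].
    apply: subspace_eq_continuous => z /set_mem zU; rewrite /from_subspace /H.
    have [//|zU'] := boolP (z \in U).
    have zK : K z by apply: fU; split => // /mem_set; rewrite (negPf zU').
    have za : z <> a by move=> za; move: zU'; rewrite za mem_set.
    rewrite /E -tT ?mem_set//; apply/esym; apply: is_angle_unit; first exact: u1.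
    apply: (is_angleZ (rho0 z za)); move: (th z zK); congr (is_angle _ _).
    rewrite /u/= !mulrA divff ?gt_eqF ?rho0// !mul1r.
    by [].
  - have : {within ~` U, continuous u}.
      apply/subspace_continuousP => z zU.
      have za : z <> a by move=> za; apply: zU; rewrite za.
      have h := @continuous_subr a z.
      apply: cvg_within_filter; apply: cvg_mkpair; apply: cvgM;
        try (exact: (cvg_pr1 h)||exact: (cvg_pr2 h)).
        by apply: cvgV; [rewrite gt_eqF// rho0 | exact: crho].
      by apply: cvgV; [rewrite gt_eqF// rho0 | exact: crho].
    apply: subspace_eq_continuous => z /set_mem zU; rewrite /from_subspace /H.
    by have [/set_mem//|//] := boolP (z \in U).
have H1 z : (H z).1 ^+ 2 + (H z).2 ^+ 2 = 1.
  rewrite /H; have [_|zU] := boolP (z \in U); first by rewrite /E/= cos2Dsin2.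
  by rewrite u1// => za; move: zU; rewrite za mem_set.
have H0 z : H z <> 0.
  by move=> h; have := H1 z; rewrite h /= expr0n /= addr0 => /eqP; rewrite eq_sym oner_eq0.
(* The factor 2 absorbs the gap between max norm and Euclidean circle: a point of the circle in [U]
   would have sine and cosine at most 1/2 in absolute value. *)
have [r r0 rE] : exists2 r : R, 0 < r & r = 2 * (`|M| + `|a| + 1).
  by eexists; last reflexivity; rewrite mulr_gt0// ltr_wpDl// addr_ge0.
have crU z : circle a r z -> ~ U z.
  move=> [s _ <-] /hM; set w := (_, _) => wM.
  have n1 : `|(w - a)| <= `|M| + `|a|.
    by rewrite (le_trans (ler_normB _ _))// lerD// (le_trans wM)// ler_norm.
  have := norm_pr1 (w - a); have := norm_pr2 (w - a).
  have -> : (w - a).1 = r * cos s by rewrite /w /=; ring.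
  have -> : (w - a).2 = r * sin s by rewrite /w /=; ring.
  rewrite !normrM (gtr0_norm r0) => /le_trans/(_ n1) h2 /le_trans/(_ n1) h1.
  have A0 : 0 <= `|M| + `|a| by rewrite addr_ge0.
  have k (x : R) : r * `|x| <= `|M| + `|a| -> x ^+ 2 <= 1 / 4.
    move=> h; have x2 : `|x| <= 1 / 2.
      have {}h : r * `|x| <= r * (1 / 2) by apply: (le_trans h); rewrite rE; lra.
      by rewrite ler_pM2l in h.
    by rewrite -real_normK ?num_real//; have := normr_ge0 x; nra.
  by have := cos2Dsin2 s; have := k _ h1; have := k _ h2; lra.
apply: (@no_angle_circle a r r0).
have := @lift_homotopy R plane (circle a r) (fun (z : plane) (s : R) => H (a + s *: (z - a))) (@circle_compact a r).
rewrite [X in has_angle _ X](_ : _ = H); last first.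
  by apply/funext => z /=; rewrite scale1r addrC subrK.
move=> []//.
- move=> [z s]; apply: (@cvg_comp _ _ _ (fun p : plane * R => a + p.2 *: (p.1 - a)) H _ (nbhs (a + s *: (z - a)))); last exact: cH.
  apply: cvgD; first exact: cvg_cst.
  apply: cvgZ; first exact: cvg_snd.
  by apply: cvgB; [exact: cvg_fst|exact: cvg_cst].
- by move=> z w _ _; rewrite !scale0r.
move=> s cs sh; exists s => // z cz.
have zU := crU z cz.
have za : z <> a by move=> za; apply: zU; rewrite za.
have r1 : 0 < (rho z)^-1 by rewrite invr_gt0 rho0.
apply: (is_angleZ r1); move: (sh z cz); rewrite /H.
by have [/set_mem//|//] := boolP (z \in U).
Qed.

(** With [m] the max norm of [v], the inner product of [v] with itself is at least [m ^+ 2], and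
    that with [d] is at least [- (m ^+ 2 / 2)]. *)
Lemma dotp_sub_gt0 (v d : plane) (e : R) : e <= `|v| -> 0 < e -> `|d| < e / 4 ->
  0 < dotp v (v + d).
Proof.
move=> ev e0 /norm_ltP[d1 d2].
set m := `|v|.
have [v1 v2] : `|v.1| <= m /\ `|v.2| <= m by apply/norm_leP.
have h : m ^+ 2 <= v.1 ^+ 2 + v.2 ^+ 2.
  rewrite /m prod_normE; case: (leP `|v.1| `|v.2|) => _; rewrite real_normK ?num_real//.
    by rewrite lerDr sqr_ge0.
  by rewrite lerDl sqr_ge0.
have m0 : 0 < m by exact: lt_le_trans ev.
have k (x y : R) : `|x| <= m -> `|y| < e / 4 -> - (m ^+ 2 / 4) <= x * y.
  move=> xm ye; have : `|x * y| <= m * (m / 4).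
    by rewrite normrM ler_pM// (le_trans (ltW ye))// ler_pM2r// invr_gt0.
  by rewrite ler_norml => /andP[]; lra.
rewrite /dotp -[(v + d).1]/(v.1 + d.1) -[(v + d).2]/(v.2 + d.2).
have := k _ _ v1 d1; have := k _ _ v2 d2; have : 0 < m ^+ 2 by rewrite exprn_gt0.
lra.
Qed.

(** Some coordinate of [b] exceeds [M] in absolute value, so all of [K] lies in an open half-plane
    bounded by a line through [b], and a constant angle can be turned into the required one. *)
Lemma has_arg_far K b M : (forall z, K z -> `|z| <= M) -> M < `|b| -> has_arg b K.
Proof.
move=> KM; rewrite prod_normE lt_max => bM.
have [d dP] : exists d : plane, forall z, K z -> 0 < dotp d (z - b).
  have side (x : R) : M < `|x| -> exists2 s : R, s ^+ 2 = 1 & forall y, `|y| <= M -> 0 < s * (y - x).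
    rewrite real_lter_normr ?num_real// => /orP[Mx|Mx].
      by exists (-1); [rewrite sqrrN expr1n | move=> y; rewrite ler_norml => /andP[]; lra].
    by exists 1; [rewrite expr1n | move=> y; rewrite ler_norml => /andP[]; lra].
  move: bM => /orP[]/side[s _ sP].
    exists (s, 0) => z /KM/norm_leP[/sP h _]; rewrite /dotp/= mul0r addr0; exact: h.
  exists (0, s) => z /KM/norm_leP[_ /sP h]; rewrite /dotp/= mul0r add0r; exact: h.
have [->|/set0P[z0 Kz0]] := eqVneq K set0.
  by exists (fun=> 0) => //; apply: continuous_subspaceT; exact: cst_continuous.
have d0 : d <> 0 by move=> d0; have := dP _ Kz0; rewrite d0 /dotp/= !mul0r addr0 ltxx.
have [t tP] := is_angle_exists d0.
apply: (@has_angle_turn _ _ _ (fun=> d)) => //.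
- by apply: continuous_subspaceT; exact: cst_continuous.
- by apply: continuous_subspaceT; exact: continuous_subr.
- by exists (fun=> t) => //; apply: continuous_subspaceT; exact: cst_continuous.
Qed.

(** Moving the base point slightly off [K] turns every vector by less than a right angle, so having
    an angle is locally constant on [U]; and [U] contains a point far from [K]. *)
Lemma has_arg_unbounded K U a : compact K -> connected U -> U `&` K = set0 ->
  ~ bounded_set U -> U a -> has_arg a K.
Proof.
move=> cK cU UK nU Ua.
have clK : closed K by apply: compact_closed cK; exact: plane_hausdorff.
have [M KM] := (bounded_setP K).1 (compact_bounded cK).
have [b Ub Mb] : exists2 b, U b & M < `|b|.
  apply: contrapT => h; apply: nU; apply/bounded_setP; exists M => x Ux.
  by rewrite leNgt; apply/negP => Mx; apply: h; exists x.
apply: (connected_locally_constant (P := fun b => has_arg b K) cU _ Ub Ua); last exact: has_arg_far KM Mb.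
move: b Ub Mb => _ _ _ b Ub.
have /nbhs_ballP[e /= e0 be] : nbhs b (~` K).
  apply: open_nbhs_nbhs; split; first exact: closed_openC.
  by move=> Kb; have : (U `&` K) b by []; rewrite UK.
have bK z : K z -> e <= `|z - b|.
  move=> Kz; rewrite leNgt; apply/negP => h; apply: (be z) => //.
  by rewrite ball_planeE /= distrC.
suff : nbhs b [set y | U y -> (has_arg y K <-> has_arg b K)] by [].
have e8 : 0 < e / 8 by rewrite divr_gt0.
apply: (filterS _ (nbhsx_ballx b _ e8)) => y; rewrite ball_planeE /= => yb _.
have d1 z : K z -> 0 < dotp (z - b) (z - y).
  move=> /bK ez; have -> : z - y = (z - b) + (b - y) by rewrite addrA subrK.
  by apply: dotp_sub_gt0 ez _ _ => //; lra.
have cs := @continuous_subr.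
split; apply: has_angle_turn; try exact: continuous_subspaceT (cs _); move=> z /d1 //.
by rewrite /dotp mulrC [X in _ + X]mulrC.
Qed.

End Winding.

(** * Arcs and separation *)

Section Separation.
Context {R : realType}.
Local Notation plane := (R * R)%type.
Local Notation I01 := (`[0%R, 1%R]%classic : set R).
Implicit Types (v p q a b : plane) (K U A B : set plane).

(** The parametrization is continuous on the whole line, obtained by clamping the parameter, so that
    restrictions to subintervals need no subspace topology. *)
Definition arc_param (g : R -> plane) p q A :=
  [/\ continuous g, {in I01 &, injective g}, g 0 = p, g 1 = q & A = g @` I01].

Lemma is_arc_param p q A : is_arc p q A -> exists g, arc_param g p q A.
Proof.
move=> [g [cg ig g0 g1 AE]].
pose cl (t : R) := Num.max 0 (Num.min 1 t).
have cl01 t : 0 <= cl t <= 1.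
  by rewrite le_max lexx ge_max ler01 ge_min lexx.
have clE t : I01 t -> cl t = t.
  by rewrite /= in_itv/= => /andP[t0 t1]; rewrite /cl min_r// max_r.
have clc : continuous cl.
  move=> t; have c1 : {for t, continuous (Num.min (1 : R))}.
    by apply: (@continuous_min _ _ (fun=> 1) id); [exact: cst_continuous|exact: cvg_id].
  have c0 : {for t, continuous (fun _ : R => 0 : R)} by exact: cst_continuous.
  exact: (continuous_max c0 c1).
exists (g \o cl); split.
- apply: within_setT_continuous; apply: (within_comp cg).
    exact: continuous_subspaceT.
  by move=> t _; rewrite /= in_itv/=; exact: cl01.
- move=> s t /set_mem sI /set_mem tI /=; rewrite !clE//.
  by apply: ig; rewrite inE.
- by rewrite /= clE//= in_itv/= lexx ler01.
- by rewrite /= clE//= in_itv/= lexx ler01.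
- by rewrite AE; apply/seteqP; split=> z [t tI <-]; exists t; rewrite //= clE.
Qed.

Lemma compact_subarc (g : R -> plane) s t : continuous g -> compact (g @` `[s, t]%classic).
Proof.
move=> cg; apply: continuous_compact; last exact: segment_compact.
exact: continuous_subspaceT.
Qed.

Lemma connected_subarc (g : R -> plane) s t : continuous g -> connected (g @` `[s, t]%classic).
Proof.
move=> cg; apply: connected_continuous_connected; first exact: segment_connected.
exact: continuous_subspaceT.
Qed.

Lemma is_arc_compact p q A : is_arc p q A -> compact A.
Proof. by move=> /is_arc_param[g [cg _ _ _ ->]]; exact: compact_subarc. Qed.

Lemma is_arc_connected p q A : is_arc p q A -> connected A.
Proof. by move=> /is_arc_param[g [cg _ _ _ ->]]; exact: connected_subarc. Qed.

Lemma is_arc_ends p q A : is_arc p q A -> A p /\ A q.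
Proof.
move=> [g [_ _ <- <- ->]]; split; [exists 0|exists 1] => //.
all: by rewrite /= in_itv/= lexx ler01.
Qed.

(** The angle is lifted along the parameter interval and transported to the arc. *)
Lemma has_arg_arc p q A a : is_arc p q A -> ~ A a -> has_arg a A.
Proof.
move=> /is_arc_param[g [cg ig _ _ ->]] Aa.
apply: has_angle_image => //; first exact: segment_compact.
  exact: continuous_subspaceT.
apply: has_angle_path.
  by move=> s; apply: cvgB; [exact: cg|exact: cvg_cst].
by move=> s s01 /eqP; rewrite subr_eq0 => /eqP sa; apply: Aa; exists s; rewrite //= in_itv.
Qed.

(* An angle of [(z - p) / (z - q)], read as complex numbers. *)
Definition has_arg2 p q U := has_angle U (fun z => cmul (z - p) (cconj (z - q))).

Lemma turnvv v : turn v v = 0.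
Proof. by rewrite /turn /crossp [v.1 * v.2]mulrC subrr mul0r atan0. Qed.

(* The angle swept by [z - g s] as [s] runs from 1 to 0 depends continuously
   on [z]. *)
Lemma is_arc_has_arg2 p q A : is_arc p q A -> has_arg2 p q (~` A).
Proof.
move=> /is_arc_param[g [cg ig gp gq AE]].
have clA : closed A.
  by rewrite AE; apply: compact_closed; [exact: plane_hausdorff|exact: compact_subarc].
have czg z : continuous (fun s => z - g s).
  by move=> s; apply: cvgB; [exact: cvg_cst|exact: cg].
have lift z : ~ A z -> has_angle I01 (fun s => z - g s).
  move=> Az; apply: has_angle_path => // s s01 /eqP; rewrite subr_eq0 => /eqP zs.
  by apply: Az; rewrite AE; exists s; rewrite //= in_itv.
(* The lifts for different [z] are unrelated; only the difference of the two end values is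
   independent of the choice, and continuity is shown for it alone. *)
have /choice[f fP] z : exists f : R -> R, ~ A z -> {within I01, continuous f} /\
    forall s, I01 s -> is_angle (z - g s) (f s).
  have [Az|Az] := pselect (A z); first by exists (fun=> 0).
  by have [f cf fa] := lift z Az; exists f.
have I0 : I01 0 by rewrite /= in_itv/= lexx ler01.
have I1 : I01 1 by rewrite /= in_itv/= lexx ler01.
exists (fun z => f z 0 - f z 1); last first.
  move=> z /fP[_ fa]; apply: is_angleM; first by rewrite -gp; exact: fa.
  by apply: is_angle_conj; rewrite -gq; exact: fa.
apply/subspace_continuousP => b Ab; apply: cvg_within_filter.
have [cfb fb] := fP b Ab.
have /nbhs_ballP[e /= e0 be] : nbhs b (~` A).
  by apply: open_nbhs_nbhs; split => //; exact: closed_openC.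
have ebg s : I01 s -> e <= `|b - g s|.
  move=> sI; rewrite leNgt; apply/negP => h; apply: (be (g s)).
    by rewrite ball_planeE.
  by rewrite AE; exists s.
have e8 : 0 < e / 8 by rewrite divr_gt0.
(* Both [f z] and [f b] corrected by [turn] are angles of [z - g s] along the interval; they differ
   by a constant, which cancels between the ends. *)
have near_eq : \forall z \near b, f b 0 - f b 1 + (turn (b - p) (z - p) - turn (b - q) (z - q))
    = f z 0 - f z 1.
  apply: (filterS _ (nbhsx_ballx b _ e8)) => z bz.
  have Az : ~ A z by apply: be; apply: le_ball bz; lra.
  have [cfz fz] := fP z Az.
  have dz s : I01 s -> 0 < dotp (b - g s) (z - g s).
    move=> /ebg es; have -> : z - g s = (b - g s) + (z - b) by rewrite [RHS]addrC addrA subrK.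
    apply: dotp_sub_gt0 es _ _ => //.
    by move: bz; rewrite ball_planeE /= distrC; lra.
  have ct : {within I01, continuous (fun s => f b s + turn (b - g s) (z - g s))}.
    move/subspace_continuousP : cfb => cfb; apply/subspace_continuousP => s sI.
    apply: cvgD; first exact: cfb.
    by apply: cvg_within_filter; apply: cvg_turn; [exact: dz|exact: czg|exact: czg].
  have at_ s : I01 s -> is_angle (z - g s) (f b s + turn (b - g s) (z - g s)).
    by move=> sI; apply: is_angle_turn; [exact: dz|exact: fb].
  have := angle_diff_const (@segment_connected R 0 1) cfz ct fz at_ I0 I1.
  rewrite gp gq; lra.
have dpos x : A x -> 0 < dotp (b - x) (b - x).
  rewrite AE => -[s sI <-]; have := @dotp_sub_gt0 _ (b - g s) 0 e (ebg s sI) e0.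
  by rewrite addr0 normr0; apply; lra.
have Ap : A p by rewrite AE -gp; exists 0.
have Aq : A q by rewrite AE -gq; exists 1.
have tp x : A x -> (fun z => turn (b - x) (z - x)) @ b --> (0 : R).
  move=> Ax; rewrite -(turnvv (b - x)); apply: cvg_turn; first exact: dpos.
    exact: cvg_cst.
  exact: continuous_subr.
have cF : (fun z => f b 0 - f b 1 + (turn (b - p) (z - p) - turn (b - q) (z - q))) @ b
    --> f b 0 - f b 1 + (0 - 0).
  by apply: cvgD; [exact: cvg_cst | apply: cvgB; exact: tp].
rewrite subr0 addr0 in cF.
exact: cvg_trans (near_eq_cvg near_eq) cF.
Qed.

Lemma has_angle_scale (T : topologicalType) (S : set T) (k : T -> R) (h : T -> plane) :
  (forall z, S z -> 0 < k z) -> has_angle S (fun z => (k z * (h z).1, k z * (h z).2)) ->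
  has_angle S h.
Proof.
by move=> k0 [t ct th]; exists t => // z Sz; apply: (is_angleZ (k0 z Sz)); exact: th.
Qed.

Lemma sqr_norm_gt0 z w : z <> w :> plane -> 0 < (z - w).1 ^+ 2 + (z - w).2 ^+ 2.
Proof.
move=> zw; have [|t] := @is_angle_exists R (z - w); last exact: is_angle_norm_gt0.
by move=> /eqP; rewrite subr_eq0 => /eqP.
Qed.

Lemma has_arg2xx p U : ~ U p -> has_arg2 p p U.
Proof.
move=> Up; exists (fun=> 0); first by apply: continuous_subspaceT; exact: cst_continuous.
move=> z Uz; have zp : z <> p by move=> zp; apply: Up; rewrite -zp.
have := sqr_norm_gt0 zp; rewrite /is_angle cos0 sin0 /cmul/=; set x := _ - _; set y := _ - _.
by move=> h; split; [move: h; congr (_ < _); ring | ring].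
Qed.

(** The product of the two quotients contains [z - q] times its conjugate, a positive factor. *)
Lemma has_arg2_trans q p r U : ~ U q -> has_arg2 p q U -> has_arg2 q r U -> has_arg2 p r U.
Proof.
move=> Uq hpq hqr; apply: (@has_angle_scale plane _ (fun z => (z - q).1 ^+ 2 + (z - q).2 ^+ 2)).
  by move=> z Uz; apply: sqr_norm_gt0 => zq; apply: Uq; rewrite -zq.
have := has_angleM hpq hqr; congr (has_angle _ _).
by apply/funext => z; rewrite /cmul /cconj /=; congr pair; ring.
Qed.

Lemma has_arg2C p q U : has_arg2 p q U -> has_arg2 q p U.
Proof.
move=> /has_angle_conj; congr (has_angle _ _).
by apply/funext => z; rewrite /cmul /cconj /=; congr pair; ring.
Qed.

(** If the complement of the union were connected, the two angles would glue to one off [A]&[B],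
    hence on a small circle around [p]. From [q] this circle has an angle as well, and multiplying
    gives it one from its centre. *)
Lemma separation A B p q : closed A -> closed B -> p <> q ->
  A `&` B `<=` [set p; q] -> has_arg2 p q (~` A) -> has_arg2 p q (~` B) ->
  ~ connected (~` (A `|` B)).
Proof.
move=> clA clB pq AB hA hB; rewrite setCU => cAB.
have := has_angle_glue_open (closed_openC clA) (closed_openC clB) cAB hA hB.
rewrite -setCI => h2.
have d0 : 0 < `|p - q| by rewrite normr_gt0 subr_eq0; apply/eqP.
have [r r0 rE] : exists2 r : R, 0 < r & r = `|p - q| / 8.
  by eexists; last reflexivity; rewrite divr_gt0.
have small (t : R) : `|(r * cos t, r * sin t) : plane| < `|p - q| / 4.
  apply/norm_ltP => /=; rewrite !normrM (gtr0_norm r0).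
  have := cos_max t; have := sin_max t => hs hc.
  have r4 : r < `|p - q| / 4 by rewrite rE; lra.
  by split; apply: le_lt_trans r4; rewrite ler_piMr// ltW.
have dq z : circle p r z -> 0 < dotp (p - q) (z - q).
  move=> [t _ <-].
  have -> : (p.1 + r * cos t, p.2 + r * sin t) - q = (p - q) + (r * cos t, r * sin t).
    by rewrite [LHS]/GRing.add/= [in RHS]/GRing.add/=; congr pair; rewrite addrAC.
  by apply: dotp_sub_gt0 (lexx _) d0 _; exact: small.
have zp z : circle p r z -> z <> p.
  move=> [t _ <-] E; have : (p.1 + r * cos t) = p.1 by rewrite -[in RHS]E.
  have : (p.2 + r * sin t) = p.2 by rewrite -[in RHS]E.
  move=> /(canRL (addKr _)); rewrite addNr => /eqP; rewrite mulf_eq0 gt_eqF//= => /eqP s0.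
  move=> /(canRL (addKr _)); rewrite addNr => /eqP; rewrite mulf_eq0 gt_eqF//= => /eqP c0.
  have := cos2Dsin2 t; rewrite s0 c0 expr0n/= addr0 => /eqP.
  by rewrite eq_sym oner_eq0.
have zq z : circle p r z -> z <> q.
  by move=> /dq + zq; rewrite zq subrr /dotp /= !mulr0 addr0 ltxx.
have hq : has_arg q (circle p r).
  have [|t tP] := @is_angle_exists R (p - q).
    by move=> /eqP; rewrite subr_eq0 => /eqP.
  apply: (@has_angle_turn _ _ _ (fun=> p - q)) => //.
  - by apply: continuous_subspaceT; exact: cst_continuous.
  - by apply: continuous_subspaceT; exact: continuous_subr.
  - by exists (fun=> t) => //; apply: continuous_subspaceT; exact: cst_continuous.
have h3 : has_arg2 p q (circle p r).
  apply: has_angle_subset h2 => z cz zAB; have /= [] := AB z zAB; [exact: zp|exact: zq].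
apply: (no_angle_circle r0).
apply: (@has_angle_scale plane _ (fun z => (z - q).1 ^+ 2 + (z - q).2 ^+ 2)).
  by move=> z /zq; exact: sqr_norm_gt0.
have := has_angleM h3 hq; congr (has_angle _ _).
by apply/funext => z; rewrite /cmul /cconj /=; congr pair; ring.
Qed.

(** If all components were unbounded, each would contain the connected exterior of a large ball, so
    there would be only one. *)
Lemma bounded_component_exists K : compact K -> ~ connected (~` K) ->
  exists2 a, ~ K a & bounded_set (connected_component (~` K) a).
Proof.
move=> cK; apply: contra_notP => h.
have [M KM] := (bounded_setP K).1 (compact_bounded cK).
pose E := [set z : plane | M < `|z|].
have EK : E `<=` ~` K by move=> z Mz /KM; rewrite leNgt => /negP; apply.
have Ea a : ~ K a -> E `<=` connected_component (~` K) a.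
  move=> Ka.
  have [b ab Mb] : exists2 b, connected_component (~` K) a b & E b.
    apply: contrapT => h'; apply: h; exists a => //; apply/bounded_setP; exists M => x ax.
    by rewrite leNgt; apply/negP => Mx; apply: h'; exists x.
  rewrite (same_connected_component ab).
  by apply: connected_component_max => //; exact: exterior_connected.
pose b : plane := (`|M| + 1, 0).
have Eb : E b.
  rewrite /E /= prod_normE lt_max /= ger0_norm ?addr_ge0//.
  by rewrite (le_lt_trans (ler_norm M))// ltrDl.
suff -> : ~` K = connected_component (~` K) b by exact: component_connected.
apply/seteqP; split=> [a Ka|]; last exact: connected_component_sub.
by apply: connected_component_sym; exact: Ea.
Qed.

End Separation.

(** * Plane drawings *)

Section Drawing.
Context {R : realType}.
Local Notation plane := (R * R)%type.
Local Notation I01 := (`[0%R, 1%R]%classic : set R).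
Context {V : finType} (e : rel V) (pt : V -> plane) (arc : V -> V -> set plane).
Hypothesis e_sym : symmetric e.
Hypothesis dr : plane_drawing e pt arc.
Implicit Types (x y u v w : V) (s c : seq V) (z : plane).

(** The base case makes the curve of a one-vertex walk a point, which starts the inductions along
    paths. *)
Fixpoint pcurve x s : set plane :=
  if s is y :: s' then arc x y `|` pcurve y s' else [set pt x].

Fixpoint pedge x s u v : bool :=
  if s is y :: s' then (u == x) && (v == y) || pedge y s' u v else false.

Lemma pt_inj : injective pt. Proof. by case: dr. Qed.

Lemma edge_arc u v : e u v -> is_arc (pt u) (pt v) (arc u v).
Proof. by case: dr => _ h _ _ /h[]. Qed.

Lemma arc_sym u v : e u v -> arc u v = arc v u.
Proof. by case: dr => _ h _ _ /h[]. Qed.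

Lemma arc_vertex u v w : e u v -> arc u v (pt w) -> w = u \/ w = v.
Proof. by case: dr => _ _ h _; exact: h. Qed.

Lemma arc_inter u v x y z : e u v -> e x y -> (u, v) <> (x, y) -> (u, v) <> (y, x) ->
  arc u v z -> arc x y z -> exists w, [/\ z = pt w, w = u \/ w = v & w = x \/ w = y].
Proof.
move=> uv xy n1 n2 h1 h2; case: dr => _ _ _ /(_ _ _ _ _ uv xy n1 n2 z (conj h1 h2)).
by move=> [w _ zw]; exists w; rewrite -zw in h1 h2; split; [|exact: arc_vertex h1|exact: arc_vertex h2].
Qed.

Lemma pedge_edge x s u v : path e x s -> pedge x s u v -> e u v.
Proof.
elim: s x => //= y s IH x /andP[xy ys] /orP[/andP[/eqP-> /eqP->]//|].
exact: IH.
Qed.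

Lemma pedge_memr x s u v : pedge x s u v -> v \in s.
Proof.
elim: s x => //= y s IH x /orP[/andP[_ /eqP->]|/IH h]; rewrite in_cons ?eqxx//.
by rewrite h orbT.
Qed.

Lemma pedge_meml x s u v : pedge x s u v -> u \in x :: s.
Proof.
elim: s x => //= y s IH x /orP[/andP[/eqP-> _]|/IH h]; rewrite in_cons ?eqxx//.
by rewrite h orbT.
Qed.

Lemma pcurveP x s z : pcurve x s z <->
  z = pt (last x s) \/ exists u v, pedge x s u v /\ arc u v z.
Proof.
elim: s x => [|y s IH] x /=.
  by split=> [|[//|[u [v []]]//]]; left.
split=> [[h|/IH[|[u [v [h1 h2]]]]]|].
- by right; exists x, y; rewrite !eqxx.
- by left.
- by right; exists u, v; rewrite h1 orbT.
- move=> [h|[u [v [/orP[/andP[/eqP-> /eqP->]|h] zz]]]]; [right|left|right] => //.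
    by apply/IH; left.
  by apply/IH; right; exists u, v.
Qed.

Lemma pcurve_head x s : path e x s -> pcurve x s (pt x).
Proof. by case: s => [//|y s] /= /andP[xy _]; left; have [] := is_arc_ends (edge_arc xy). Qed.

Lemma pcurve_last x s : pcurve x s (pt (last x s)).
Proof. by apply/pcurveP; left. Qed.

Lemma pcurve_vertex x s w : path e x s -> pcurve x s (pt w) -> w \in x :: s.
Proof.
move=> xs /pcurveP[/pt_inj->|[u [v [h]]]]; first exact: mem_last.
move=> /(arc_vertex (pedge_edge xs h)) [->|->]; first exact: pedge_meml h.
by rewrite in_cons (pedge_memr h) orbT.
Qed.

Lemma pcurve_mem x s w : path e x s -> w \in x :: s -> pcurve x s (pt w).
Proof.
elim: s x => [|y s IH] x /=; first by rewrite mem_seq1 => _ /eqP->.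
move=> /andP[xy ys]; rewrite in_cons => /orP[/eqP->|h]; last by right; exact: IH.
by left; have [] := is_arc_ends (edge_arc xy).
Qed.

Lemma arc_pcurve_inter u v x s z : e u v -> path e x s ->
  ~~ pedge x s u v -> ~~ pedge x s v u -> arc u v z -> pcurve x s z ->
  exists w, [/\ z = pt w, w = u \/ w = v & w \in x :: s].
Proof.
move=> uv xs n1 n2 h1 h2.
suff [w [zw hw]] : exists w, z = pt w /\ (w = u \/ w = v).
  by exists w; split => //; rewrite zw in h2; exact: pcurve_vertex h2.
case/pcurveP: (h2) => [zE|[a [b [ab abz]]]].
  by exists (last x s); split => //; apply: arc_vertex => //; rewrite -zE.
have [||w [-> hw _]] := arc_inter uv (pedge_edge xs ab) _ _ h1 abz.
- by move=> [ua vb]; move: n1; rewrite ua vb ab.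
- by move=> [ua vb]; move: n2; rewrite ua vb ab.
- by exists w.
Qed.

Lemma pcurve_inter x s y t z : path e x s -> path e y t ->
  (forall u v, pedge x s u v -> ~~ pedge y t u v && ~~ pedge y t v u) ->
  pcurve x s z -> pcurve y t z ->
  exists w, [/\ z = pt w, w \in x :: s & w \in y :: t].
Proof.
move=> xs yt H h1 h2.
suff [w zw] : exists w, z = pt w.
  by exists w; rewrite zw in h1 h2; split => //; [exact: pcurve_vertex h1|exact: pcurve_vertex h2].
case/pcurveP: (h1) => [zE|[a [b [ab abz]]]]; first by exists (last x s).
have /andP[n1 n2] := H _ _ ab.
by have [w [-> _ _]] := arc_pcurve_inter (pedge_edge xs ab) yt n1 n2 abz h2; exists w.
Qed.

Lemma pcurve_compact x s : path e x s -> compact (pcurve x s).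
Proof.
elim: s x => [|y s IH] x /=; first by move=> _; exact: compact_set1.
move=> /andP[xy /IH]; apply: compactU; exact: is_arc_compact (edge_arc xy).
Qed.

Lemma pcurve_closed x s : path e x s -> closed (pcurve x s).
Proof. by move=> /pcurve_compact; apply: compact_closed; exact: plane_hausdorff. Qed.

Lemma pcurve_connected x s : path e x s -> connected (pcurve x s).
Proof.
elim: s x => [|y s IH] x /=; first by move=> _; exact: connected1.
move=> /andP[xy ys]; apply: connectedU; last exact: IH.
  exists (pt y); split; last exact: pcurve_head.
  by have [] := is_arc_ends (edge_arc xy).
exact: is_arc_connected (edge_arc xy).
Qed.

(** The first arc meets the rest of the path in the single point [pt y], so angles glue there. *)
Lemma has_arg_pcurve z x s : path e x s -> uniq (x :: s) -> ~ pcurve x s z ->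
  has_arg z (pcurve x s).
Proof.
elim: s x => [|y s IH] x.
  move=> _ _ /= xz; have [|t tP] := @is_angle_exists R (pt x - z).
    by move=> /eqP; rewrite subr_eq0 => /eqP xz'; apply: xz.
  exists (fun=> t); first by apply: continuous_subspaceT; exact: cst_continuous.
  by move=> _ ->.
move=> /= /andP[xy ys] /andP[xys uys] /not_orP[z1 z2].
apply: has_angle_glue; last exact: IH.
- by apply: compact_closed; [exact: plane_hausdorff|exact: is_arc_compact (edge_arc xy)].
- exact: pcurve_closed.
- suff -> : arc x y `&` pcurve y s = [set pt y] by exact: connected1.
  apply/seteqP; split=> [p [h1 h2]|_ ->]; last first.
    by split; [have [] := is_arc_ends (edge_arc xy)|exact: pcurve_head].
  have [||w [-> [->|->//]]] := arc_pcurve_inter xy ys _ _ h1 h2; last by rewrite (negPf xys).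
    by apply: contra xys => /pedge_meml.
  by apply: contra xys => /pedge_memr; rewrite in_cons orbC => ->.
- exact: has_arg_arc (edge_arc xy) z1.
Qed.

Lemma pcurve_has_arg2 x s : path e x s -> has_arg2 (pt x) (pt (last x s)) (~` pcurve x s).
Proof.
elim: s x => [|y s IH] x /=; first by move=> _; apply: has_arg2xx => /=; apply.
move=> /andP[xy ys]; apply: (@has_arg2_trans _ (pt y)).
- by apply; right; exact: pcurve_head.
- apply: has_angle_subset (is_arc_has_arg2 (edge_arc xy)).
  by apply: subsetC; exact: subsetUl.
- apply: has_angle_subset (IH _ ys).
  by apply: subsetC; exact: subsetUr.
Qed.

Lemma pcurve_cat x s t : path e x (s ++ t) ->
  pcurve x (s ++ t) = pcurve x s `|` pcurve (last x s) t.
Proof.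
elim: s x => [|y s IH] x /=.
  by move=> /pcurve_head h; apply/esym/setUidr => _ ->.
by move=> /andP[_ /IH->]; rewrite setUA.
Qed.

Lemma pcurve_rev x s : path e x s -> pcurve (last x s) (rev (belast x s)) = pcurve x s.
Proof.
elim: s x => [|y s IH] x //= /andP[xy ys].
have p1 : path e (last y s) (rev (belast y s)).
  by rewrite rev_path; apply: sub_path ys => a b; rewrite e_sym.
have L : last (last y s) (rev (belast y s)) = y.
  by case: (s) => //= w s'; rewrite rev_cons last_rcons.
rewrite rev_cons -cats1 pcurve_cat; last first.
  by rewrite cat_path p1 L /= e_sym xy.
rewrite L IH// setUC; congr (_ `|` _) => /=; rewrite (arc_sym xy).
apply/seteqP; split=> [p [//|->]|p]; last by left.
by rewrite -(arc_sym xy); have [] := is_arc_ends (edge_arc xy).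
Qed.

Lemma pedge_next x s y0 u v : uniq (x :: s) ->
  pedge x (rcons s y0) u v = (u \in x :: s) && (v == next_at u y0 x s).
Proof.
elim: s x => [|y s IH] x; first by rewrite /= mem_seq1 orbF; case: eqP.
move=> /= /andP[xys uys]; rewrite IH// [in RHS]in_cons.
have [->|ux] := eqVneq u x; last by [].
by rewrite (negPf xys)/= orbF.
Qed.

Lemma cycle_curve_pcurve x s : cycle e (x :: s) -> uniq (x :: s) ->
  cycle_curve arc (x :: s) = pcurve x (rcons s x).
Proof.
move=> cs us; apply/seteqP; split=> [z [u us' h]|z /pcurveP[|[u [v []]]]].
- by apply/pcurveP; right; exists u, (next (x :: s) u); rewrite pedge_next ?us' ?eqxx.
- rewrite last_rcons => ->; exists x; first exact: mem_head.
  by have [] := is_arc_ends (edge_arc (next_cycle cs (mem_head x s))).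
- by rewrite pedge_next// => /andP[us' /eqP->] h; exists u.
Qed.

Lemma cycle_curve_rot n c : uniq c -> cycle_curve arc (rot n c) = cycle_curve arc c.
Proof.
by move=> uc; apply/seteqP; split=> z [v vc h]; exists v;
  rewrite ?mem_rot// ?next_rot// in vc h *.
Qed.

(** Rotating the cycle to start at [v] presents its curve as one arc and a path between the same
    ends; [s] is nonempty because the cycle has at least three vertices. *)
Lemma cycle_split c v : graph_cycle e c -> v \in c ->
  exists y s, [/\ s <> [::], e v y, path e y (rcons s v), uniq (v :: y :: s)
    & y = next c v /\ cycle_curve arc c = arc v y `|` pcurve y (rcons s v)].
Proof.
move=> [sz /andP[cc uc]] vc; have [i s' rE] := rot_to vc.
have := rot_cycle i e c; rewrite cc; have := rot_uniq i c; rewrite uc.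
have := size_rot i c; rewrite -(cycle_curve_rot i uc) -(next_rot i uc) rE.
case: s' {rE} => [|y [|w s]] E u' c'; rewrite -?E // in sz.
exists y, (w :: s); split => //.
- by move: c' => /= /andP[].
- by move: c' => /= /andP[].
- by rewrite cycle_curve_pcurve//= eqxx.
Qed.

(** For empty [s] the rest would be the same arc run backwards. *)
Lemma arc_rest_inter v y s z : s <> [::] -> e v y -> path e y (rcons s v) ->
  uniq (v :: y :: s) -> arc v y z -> pcurve y (rcons s v) z -> z = pt v \/ z = pt y.
Proof.
move=> s0 vy ys us h1 h2.
have [] := arc_pcurve_inter vy ys _ _ h1 h2; last first.
- by move=> w [-> [->|->] _]; [left|right].
- case: s s0 us {ys h2} => // w s _ us; rewrite rcons_cons /=.
  apply/negP => /orP[/andP[_ /eqP vw]|/pedge_meml].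
    by move: us; rewrite vw /= !in_cons eqxx orbT.
  move: us => /= /andP[/[!in_cons]/norP[vy' _] /andP[/norP[yw ys] _]].
  by rewrite mem_rcons ?in_cons [y == v]eq_sym (negPf vy') (negPf yw) (negPf ys).
- apply/negP => /pedge_memr; rewrite mem_rcons; move: us => /= /andP[/[!in_cons]/norP[vy' _] /andP[ys' _]].
  by rewrite eq_sym (negPf vy') (negPf ys').
Qed.

Lemma cycle_curve_compact c : graph_cycle e c -> compact (cycle_curve arc c).
Proof.
case: c => [[]//|v c] gc; have [y [s [_ vy ys _ [_ ->]]]] := cycle_split gc (mem_head v c).
apply: compactU; [exact: is_arc_compact (edge_arc vy)|exact: pcurve_compact].
Qed.

Lemma cycle_curve_closed c : graph_cycle e c -> closed (cycle_curve arc c).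
Proof. by move=> /cycle_curve_compact; apply: compact_closed; exact: plane_hausdorff. Qed.

Lemma cycle_curve_mem c v : graph_cycle e c -> v \in c -> cycle_curve arc c (pt v).
Proof.
move=> gc vc; have [y [s [_ vy _ _ [_ ->]]]] := cycle_split gc vc.
by left; have [] := is_arc_ends (edge_arc vy).
Qed.

Lemma cycle_curve_vertex c v : graph_cycle e c -> cycle_curve arc c (pt v) -> v \in c.
Proof.
move=> [_ /andP[cc uc]] [u uc' h].
have [->//|->] := arc_vertex (next_cycle cc uc') h.
by rewrite mem_next.
Qed.

(** An arc of the cycle and the remaining path meet only in their common ends, so [separation]
    applies. *)
Lemma cycle_bounded_component c : graph_cycle e c ->
  exists2 a : plane, ~ cycle_curve arc c a
    & bounded_set (connected_component (~` cycle_curve arc c) a).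
Proof.
move=> gc; have cK := cycle_curve_compact gc.
apply: bounded_component_exists cK _.
case: c gc => [[]//|v c] gc; have [y [s [s0 vy ys us [_ ->]]]] := cycle_split gc (mem_head v c).
apply: (@separation _ _ _ (pt v) (pt y)).
- by apply: compact_closed; [exact: plane_hausdorff|exact: is_arc_compact (edge_arc vy)].
- exact: pcurve_closed.
- by move=> /pt_inj E; move: us; rewrite E /= in_cons eqxx.
- by move=> z [h1 h2]; have [->|->] := arc_rest_inter s0 vy ys us h1 h2; [left|right].
- exact: is_arc_has_arg2 (edge_arc vy).
- by have := pcurve_has_arg2 ys; rewrite last_rcons => /has_arg2C.
Qed.

(* Were [p] on the curve but away from the closure of the component [J], a
   subarc around [p] could be deleted while the remaining arc still contains
   the frontier of [J]; but an arc bounds no bounded open set. *)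
Lemma cycle_component_closure c (a : plane) : graph_cycle e c -> ~ cycle_curve arc c a ->
  bounded_set (connected_component (~` cycle_curve arc c) a) ->
  cycle_curve arc c `<=` closure (connected_component (~` cycle_curve arc c) a).
Proof.
move=> gc Ca; set C := cycle_curve arc c; set J := connected_component _ _ => bJ p Cp.
have clC := cycle_curve_closed gc.
have Ja : J a by exact: connected_component_refl.
have oJ : open J by exact: component_open.
apply: contrapT => /existsNP[N /not_implyP[/nbhs_ballP[d /= d0 dN] nN]].
have pJ : ball p d `&` J = set0.
  by apply/eqP; apply: contra_notT nN => /set0P[z [/dN zN Jz]]; exists z.
case: (Cp) => v vc; have [y [s [s0 vy ys us [yE CE]]]] := cycle_split gc vc.
rewrite -yE => pvy; rewrite -/C in CE.
have [g [cg ig g0 g1 gE]] := is_arc_param (edge_arc vy).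
have [t0 t0I gt0] : (g @` I01) p by rewrite -gE.
have /nbhs_ballP[r /= r0 rP] : nbhs t0 (g @^-1` ball p d).
  by apply: cg; rewrite gt0; exact: nbhsx_ballx.
(* The interval is taken to the right of [t0], except for [t0 = 1], where it must lie to the
   left. *)
have [t1 [t2 [t12 t10 t21 tP]]] : exists t1 t2 : R, [/\ t1 < t2, 0 <= t1, t2 <= 1
    & forall t, t1 <= t <= t2 -> ball p d (g t)].
  move: t0I; rewrite /= in_itv/= => /andP[t00 t01].
  have near_t t : `|t0 - t| < r -> ball p d (g t) by exact: rP.
  have [t01'|t01'] := ltP t0 1.
    exists t0, (Num.min 1 (t0 + r / 2)); split => //.
    - by rewrite lt_min t01' ltrDl divr_gt0.
    - by rewrite ge_min lexx.
    - move=> t /andP[h1]; rewrite le_min => /andP[_ h2]; apply: near_t.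
      by rewrite ltr_norml; apply/andP; split; lra.
  exists (Num.max 0 (1 - r / 2)), 1; split => //.
  - by rewrite gt_max ltr01 /=; lra.
  - by rewrite le_max lexx.
  - move=> t /andP[]; rewrite ge_max => /andP[_ h1] h2; apply: near_t.
    by rewrite ltr_norml; apply/andP; split; lra.
pose B := pcurve y (rcons s v).
pose K1 := g @` `[0, t1]%classic; pose K2 := g @` `[t2, 1]%classic.
have sub1 t : `[0, t1]%classic t -> I01 t by rewrite /= !in_itv/= => /andP[? ?]; apply/andP; split; lra.
have sub2 t : `[t2, 1]%classic t -> I01 t by rewrite /= !in_itv/= => /andP[? ?]; apply/andP; split; lra.
have K1A : K1 `<=` arc v y by rewrite gE => _ [t /sub1 tI <-]; exists t.
have K2A : K2 `<=` arc v y by rewrite gE => _ [t /sub2 tI <-]; exists t.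
have I0 : I01 0 by rewrite /= in_itv/= lexx ler01.
have I1 : I01 1 by rewrite /= in_itv/= lexx ler01.
have gI (t t' : R) : I01 t -> I01 t' -> g t = g t' -> t = t' by move=> tI uI; apply: ig; rewrite inE.
have BA t : I01 t -> B (g t) -> t = 0 \/ t = 1.
  move=> tI Bt; have [] := arc_rest_inter s0 vy ys us _ Bt; first by rewrite gE; exists t.
    by rewrite -g0 => /gI; left; auto.
  by rewrite -g1 => /gI; right; auto.
have K1B : K1 `&` B = [set pt v].
  apply/seteqP; split=> [z [[t tI <-] /BA[|->//|t1E]]|_ ->].
  - exact: sub1.
  - by exfalso; move: tI; rewrite t1E /= in_itv/= => /andP[]; lra.
  - split; last by rewrite -[v in pt v](last_rcons y s); exact: pcurve_last.
    by rewrite -g0; exists 0; rewrite //= in_itv/= lexx.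
have K2B : (K1 `|` B) `&` K2 = [set pt y].
  apply/seteqP; split=> [z [[[t tI <-]|zB] [u uI]]|_ ->].
  - move=> /(gI _ _ (sub2 _ uI) (sub1 _ tI)) E; exfalso; move: tI uI; rewrite E /= !in_itv/= => /andP[_ ?] /andP[? _]; lra.
  - move=> E; rewrite -E in zB *; have [uE|->] := BA u (sub2 _ uI) zB; last by rewrite g1.
    by exfalso; move: uI; rewrite uE /= in_itv/= => /andP[]; lra.
  - split; last by rewrite -g1; exists 1; rewrite //= in_itv/= lexx andbT.
    by right; exact: pcurve_head.
have nC : ~ (arc v y `|` B) a by rewrite -CE.
have hA : has_arg a (arc v y) by apply: has_arg_arc (edge_arc vy) _ => h; apply: nC; left.
have hB : has_arg a B.
  apply: has_arg_pcurve => //; last by move=> h; apply: nC; right.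
  by rewrite -rcons_cons rcons_uniq.
have clK1 : closed K1 by apply: compact_closed; [exact: plane_hausdorff|exact: compact_subarc].
have clK2 : closed K2 by apply: compact_closed; [exact: plane_hausdorff|exact: compact_subarc].
have clB : closed B by exact: pcurve_closed.
(* [K1] and [B] share only [pt v], and [K2] meets their union only in [pt y], so the angles glue at
   single points. *)
have h1 : has_arg a (K1 `|` B).
  by apply: has_angle_glue => //; [rewrite K1B; exact: connected1|exact: has_angle_subset hA].
have h2 : has_arg a ((K1 `|` B) `|` K2).
  apply: has_angle_glue => //; first exact: closedU.
  - by rewrite K2B; exact: connected1.
  - exact: has_angle_subset hA.
apply: (no_arg_bounded oJ bJ _ _ Ja h2).
  by apply: compactU; [apply: compactU; [exact: compact_subarc|exact: pcurve_compact]|exact: compact_subarc].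
(* A frontier point on the deleted subarc would lie in the ball that misses [J]. *)
move=> z zJ; have := component_frontier clC zJ; rewrite -/C CE => -[|zB]; last by left; right.
rewrite gE => -[t tI tz]; move: (tI); rewrite /= in_itv/= => /andP[t00 t11].
have [tt1|tt1] := leP t t1; first by left; left; exists t; rewrite //= in_itv/= t00.
have [tt2|tt2] := leP t2 t; first by right; exists t; rewrite //= in_itv/= t11 andbT.
have zb : ball p d z by rewrite -tz; apply: tP; rewrite !ltW.
have : ball p d `&` J !=set0.
  have := zJ.1 (ball p d); rewrite setIC; apply.
  by apply: open_nbhs_nbhs; split => //; exact: ball_open.
by rewrite pJ => -[].
Qed.

Lemma cycle_component_boundary c (a : plane) : graph_cycle e c -> ~ cycle_curve arc c a ->
  bounded_set (connected_component (~` cycle_curve arc c) a) ->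
  boundary (connected_component (~` cycle_curve arc c) a) = cycle_curve arc c.
Proof.
move=> gc Ca bJ; have clC := cycle_curve_closed gc; rewrite /boundary.
have oJ : open (connected_component (~` cycle_curve arc c) a) by exact: component_open.
apply/seteqP; split=> [z [zJ]|z Cz].
  rewrite -(closure_id _).1; last exact: open_closedC.
  by move=> nz; exact: (component_frontier clC (conj zJ nz)).
split; first exact: cycle_component_closure.
by apply: subset_closure => /connected_component_sub; apply.
Qed.

End Drawing.

(** * Cycles of an outerplane graph *)

Section Outerplane.
Context {R : realType}.
Local Notation plane := (R * R)%type.
Local Notation I01 := (`[0%R, 1%R]%classic : set R).
Context {V : finType} (e : rel V) (pt : V -> plane) (arc : V -> V -> set plane).
Hypothesis e_sym : symmetric e.
Hypothesis op : outerplane e pt arc.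
Implicit Types (x y u v w : V) (s c : seq V).

Let dr : plane_drawing e pt arc := op.1.
Local Notation C c := (cycle_curve arc c).
Local Notation J c p := (connected_component (~` C c) p).

Lemma cycle_curve_support c : graph_cycle e c -> C c `<=` drawing_support e pt arc.
Proof.
by move=> [_ /andP[cc _]] z [v vc h]; right; exists v, (next c v); split => //; exact: next_cycle.
Qed.

(** The component is a neighbourhood of the vertex, so it meets the exterior face, which is
    connected and avoids the cycle. It would then contain this unbounded face. *)
Lemma component_no_vertex c (p : plane) v : graph_cycle e c -> bounded_set (J c p) -> ~ J c p (pt v).
Proof.
move=> gc bJ Jv; have [_ [F [[[q sq FE] nbF] Fv]]] := op.
have oJ : open (J c p) by apply: component_open; exact: (cycle_curve_closed dr gc).
have [clv _] := Fv v.
have [z [Fz Jz]] := clv _ (open_nbhs_nbhs (conj oJ Jv)).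
apply: nbF; have FJ : F `<=` J c p.
  rewrite (same_connected_component Jz); apply: connected_component_max => //.
    rewrite FE; apply: subset_trans (@connected_component_sub _ _ _) _.
    by apply: subsetC; exact: cycle_curve_support.
  by rewrite FE; exact: component_connected.
have [M hM] := (bounded_setP _).1 bJ.
by apply/bounded_setP; exists M => w /FJ/hM.
Qed.

(** Following the arc from [z] back to [u] does not meet the cycle, since [u] is off it and only the
    far end [v] may be on it; so [u] would lie in the component. *)
Lemma component_no_edge c (p : plane) u v z : graph_cycle e c -> bounded_set (J c p) ->
  e u v -> u \notin c -> arc u v z -> ~ J c p z.
Proof.
move=> gc bJ uv uc; have [g [cg ig g0 g1 gE]] := is_arc_param (edge_arc dr uv).
rewrite gE => -[t tI <-] Jt.
have [t1|t1] := eqVneq t 1; first by move: Jt; rewrite t1 g1; exact: component_no_vertex.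
apply: (component_no_vertex gc bJ (v := u)); rewrite -g0.
rewrite (same_connected_component Jt).
move: (tI); rewrite /= in_itv/= => /andP[t0 t11].
apply: (@connected_component_max _ _ (g @` `[0, t]%classic)).
- by exists t; rewrite //= in_itv/= t0 lexx.
- move=> _ [s sI <-] [w wc hw].
  move: (sI); rewrite /= in_itv/= => /andP[s0 st].
  have sI' : I01 s by rewrite /= in_itv/= s0 (le_trans st).
  have [cc uc'] := andP gc.2.
  have wn : e w (next c w) by exact: next_cycle.
  have [|||x [gx [xu|xv] xw]] := arc_inter dr uv wn _ _ _ hw.
  + by move=> [uw _]; move: uc; rewrite uw wc.
  + by move=> [uw _]; move: uc; rewrite uw mem_next wc.
  + by rewrite gE; exists s.
  + by move: uc; rewrite -xu; case: xw => ->; rewrite ?mem_next wc.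
  + have s1 : s = 1.
      apply: ig; rewrite ?gx ?xv ?g1// inE //.
      by rewrite /= in_itv/= ler01 lexx.
    by move: t1; rewrite eq_le t11 -s1 st.
- exact: (connected_subarc cg).
- by exists 0; rewrite //= in_itv/= lexx t0.
Qed.

Lemma component_no_edgeP c (p : plane) u v z : graph_cycle e c -> bounded_set (J c p) ->
  e u v -> ~~ ((u \in c) && (v \in c)) -> arc u v z -> ~ J c p z.
Proof.
move=> gc bJ uv; rewrite negb_and => /orP[uc|vc]; first exact: component_no_edge.
by rewrite (arc_sym dr uv); apply: component_no_edge => //; rewrite e_sym.
Qed.

(** Every edge with both ends on the cycle belongs to it, so a bounded component of its complement
    misses the whole drawing and is a face. *)
Lemma induced_cycle_face c : graph_cycle e c ->
  (forall u v, u \in c -> v \in c -> e u v -> v = next c u \/ u = next c v) ->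
  exists F, internal_face e pt arc F /\ face_length e arc F (size c).
Proof.
move=> gc ind; have [a Ca bJ] := cycle_bounded_component dr gc.
have Ja : J c a a by exact: connected_component_refl.
have JS z : J c a z -> ~ drawing_support e pt arc z.
  move=> Jz [[v zv]|[u [v [uv zuv]]]].
    by apply: (component_no_vertex (v := v) gc bJ); rewrite -zv.
  have [/andP[uc vc]|n] := boolP ((u \in c) && (v \in c)); last first.
    exact: (component_no_edgeP gc bJ uv n zuv).
  apply: (connected_component_sub Jz).
  have [vE|uE] := ind u v uc vc uv; first by exists u => //; rewrite -vE.
  by exists v => //; rewrite -uE (arc_sym dr) // e_sym.
exists (J c a); split; last by exists c; split => //; exact: (cycle_component_boundary dr gc Ca bJ).
split => //; exists a; first exact: JS.
apply/seteqP; split.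
  by apply: connected_component_max => //; exact: component_connected.
apply: connected_component_max; [|exact: subset_trans (@connected_component_sub _ _ _) (subsetC (cycle_curve_support gc))|exact: component_connected].
by apply: connected_component_refl; exact: JS.
Qed.

Lemma two_paths_cycle a b s t : path e a (rcons s b) -> path e a (rcons t b) ->
  uniq (a :: b :: s ++ t) -> s <> [::] -> t <> [::] ->
  graph_cycle e (a :: s ++ b :: rev t) /\
  C (a :: s ++ b :: rev t) = pcurve pt arc a (rcons s b) `|` pcurve pt arc a (rcons t b).
Proof.
move=> ps pt' us s0 t0.
have eq1 : rcons (s ++ b :: rev t) a = rcons s b ++ rcons (rev t) a.
  by rewrite -!cats1 -!catA.
have pr : path e b (rcons (rev t) a).
  have := rev_path e a (rcons t b); rewrite last_rcons belast_rcons rev_cons => ->.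
  by apply: sub_path pt' => x y; rewrite e_sym.
have cc : cycle e (a :: s ++ b :: rev t).
  by rewrite /= eq1 cat_path ps last_rcons.
have uc : uniq (a :: s ++ b :: rev t).
  rewrite (@perm_uniq _ _ (a :: b :: s ++ t))//= perm_cons -cat1s perm_catCA/= perm_cons.
  by rewrite perm_cat2l perm_rev.
split.
  split; last by rewrite /ucycle cc uc.
  by rewrite /= size_cat /= size_rev; case: (s) s0 => //= ? ? _; rewrite !addnS.
rewrite (cycle_curve_pcurve dr cc uc) eq1 (pcurve_cat dr); last by rewrite cat_path ps last_rcons.
congr (_ `|` _); rewrite last_rcons.
have := pcurve_rev e_sym dr pt'; rewrite last_rcons belast_rcons rev_cons //.
Qed.

Lemma pedge_interior a b s u v : s <> [::] -> pedge a (rcons s b) u v -> u \in s \/ v \in s.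
Proof.
case: s => // w s _ /=.
move=> /orP[/andP[_ /eqP->]|]; first by right; exact: mem_head.
elim: s w => [|w' s IH] w /=.
  by rewrite orbF => /andP[/eqP-> _]; left; exact: mem_head.
move=> /orP[/andP[/eqP-> _]|/IH[]]; first by left; exact: mem_head.
  by rewrite !in_cons => /orP[]->; rewrite ?orbT; left.
by rewrite !in_cons => /orP[]->; rewrite ?orbT; right.
Qed.

Lemma interior_notin a b s t x : uniq (a :: b :: s ++ t) -> x \in s -> x \notin a :: rcons t b.
Proof.
rewrite /= in_cons mem_cat cat_uniq => /and3P[/norP[ab /norP[as_ at_]]].
rewrite mem_cat => /norP[bs bt] /and3P[us /hasPn st ut] xs.
rewrite in_cons mem_rcons in_cons !negb_or.
rewrite (memPn as_ _ xs) (memPn bs _ xs)/=; apply/negP => /st; by rewrite /= xs.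
Qed.

Lemma two_paths_inter a b s t z : path e a (rcons s b) -> path e a (rcons t b) ->
  uniq (a :: b :: s ++ t) -> s <> [::] ->
  pcurve pt arc a (rcons s b) z -> pcurve pt arc a (rcons t b) z -> z = pt a \/ z = pt b.
Proof.
move=> ps pt' us s0 h1 h2.
have st := interior_notin us.
have [|w [-> w1 w2]] := pcurve_inter dr ps pt' _ h1 h2.
  move=> u v /(pedge_interior s0)[]/st n; apply/andP; split; apply: contra n.
  - by move=> /pedge_meml.
  - by move=> /pedge_memr h; rewrite in_cons h orbT.
  - by move=> /pedge_memr h; rewrite in_cons h orbT.
  - by move=> /pedge_meml.
move: w1; rewrite in_cons mem_rcons in_cons => /orP[/eqP->|/orP[/eqP->|/st]].
- by left.
- by right.
- by rewrite w2.
Qed.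

(** * Absence of thetas *)

Section Theta.
Variables a b : V.
Local Notation P s := (pcurve pt arc a (rcons s b)).
Local Notation comp s r q := (connected_component (~` (P s `|` P r)) q).

Definition theta s r t : Prop :=
  [/\ path e a (rcons s b), path e a (rcons r b) & path e a (rcons t b)] /\
  [/\ s <> [::], r <> [::], t <> [::] & uniq (a :: b :: s ++ r ++ t)].

Lemma theta_swap12 s r t : theta s r t -> theta r s t.
Proof.
move=> [[ps pr pt'] [s0 r0 t0 us]]; do 2 split=> //.
by rewrite (@perm_uniq _ _ (a :: b :: s ++ r ++ t))// !perm_cons perm_catCA.
Qed.

Lemma theta_swap23 s r t : theta s r t -> theta s t r.
Proof.
move=> [[ps pr pt'] [s0 r0 t0 us]]; do 2 split=> //.
by rewrite (@perm_uniq _ _ (a :: b :: s ++ r ++ t))// !perm_cons perm_cat2l perm_catC.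
Qed.

Lemma theta_uniq12 s r t : theta s r t -> uniq (a :: b :: s ++ r).
Proof.
move=> [_ [_ _ _]]; apply: subseq_uniq; rewrite /= !eqxx catA; exact: prefix_subseq.
Qed.

Lemma theta_cycle s r t : theta s r t ->
  graph_cycle e (a :: s ++ b :: rev r) /\ C (a :: s ++ b :: rev r) = P s `|` P r.
Proof.
by move=> th; have u := theta_uniq12 th; case: th => -[? ? ?] [? ? ? _]; exact: two_paths_cycle.
Qed.

Lemma theta_notin s r t x : theta s r t -> x \in t -> x \notin a :: s ++ b :: rev r.
Proof.
move=> [_ [_ _ _ us]] xt.
have us' : uniq (a :: b :: t ++ (s ++ r)).
  by rewrite (@perm_uniq _ _ (a :: b :: s ++ r ++ t))// !perm_cons perm_catC -catA.
have := interior_notin us' xt; apply: contra.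
rewrite !in_cons mem_rcons !(mem_cat, in_cons) mem_rev.
by move=> /orP[->//|/orP[->|/orP[->|->]]]; rewrite ?orbT.
Qed.

(** Every edge of the third path has an interior vertex as an end, and this vertex is off the cycle
    of the other two. *)
Lemma theta_avoid s r t q z : theta s r t -> bounded_set (comp s r q) -> P t z ->
  ~ comp s r q z.
Proof.
move=> th; have [gc <-] := theta_cycle th => bJ.
have tc x : x \in t -> x \notin a :: s ++ b :: rev r by exact: theta_notin.
case: th => -[_ _ pt'] [_ _ t0 _].
move=> /pcurveP[->|[u [v [uv zuv]]]]; first exact: component_no_vertex.
apply: (component_no_edgeP gc bJ (pedge_edge pt' uv) _ zuv).
by have [/tc|/tc] := pedge_interior t0 uv => n; rewrite (negPf n) ?andbF.
Qed.

(** Two bounded components at [q] would each avoid the remaining path, hence coincide. Their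
    boundaries, the two cycles, would coincide too, although a vertex of [r] lies on only one. *)
Lemma theta_component s r t q : theta s r t -> ~ (P s `|` P r) q -> bounded_set (comp s r q) ->
  ~ bounded_set (comp s t q).
Proof.
move=> th q1 b1 b2; have th' := theta_swap23 th.
have q2 : ~ (P s `|` P t) q.
  move=> [h|h]; first by apply: q1; left.
  by apply: (theta_avoid th b1 h); exact: connected_component_refl.
have sub12 : comp s r q `<=` comp s t q.
  apply: connected_component_max; [exact: connected_component_refl| |exact: component_connected].
  move=> z Jz [h|h]; last exact: theta_avoid th b1 h Jz.
  by have := connected_component_sub Jz; apply; left.
have sub21 : comp s t q `<=` comp s r q.
  apply: connected_component_max; [exact: connected_component_refl| |exact: component_connected].
  move=> z Jz [h|h]; last exact: theta_avoid th' b2 h Jz.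
  by have := connected_component_sub Jz; apply; left.
have E : comp s r q = comp s t q by apply/seteqP.
have [gc Cc] := theta_cycle th; have [gc' Cc'] := theta_cycle th'.
rewrite -Cc in q1 b1 E; rewrite -Cc' in q2 b2 E.
have := cycle_component_boundary dr gc q1 b1.
rewrite E (cycle_component_boundary dr gc' q2 b2) => CC.
have [w wr] : exists w, w \in r.
  by case: th => _ [_ + _ _]; case: (r) => // w r' _; exists w; exact: mem_head.
have : w \in a :: s ++ b :: rev t.
  apply: (cycle_curve_vertex dr gc'); rewrite CC; apply: (cycle_curve_mem dr gc).
  by rewrite !(in_cons, mem_cat) mem_rev wr !orbT.
apply/negP; exact: theta_notin th' wr.
Qed.

Lemma theta_has_arg s r t q : theta s r t -> ~ (P s `|` P r) q -> bounded_set (comp s r q) ->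
  has_arg q (P s `|` P t).
Proof.
move=> th q1 b1; have th' := theta_swap23 th.
have q2 : ~ (P s `|` P t) q.
  move=> [h|h]; first by apply: q1; left.
  by apply: (theta_avoid th b1 h); exact: connected_component_refl.
apply: (has_arg_unbounded _ _ _ (theta_component th q1 b1)).
- by have [gc <-] := theta_cycle th'; exact: (cycle_curve_compact dr gc).
- exact: component_connected.
- by apply/seteqP; split=> z // -[/connected_component_sub].
- exact: connected_component_refl.
Qed.

(* If [p] lies in a bounded component of the complement of [P s1 `|` P s2], then
   it lies in the unbounded components of the complements of the two other
   cycles; the angles these yield agree on [P s3] and glue. *)
Lemma no_theta s1 s2 s3 : ~ theta s1 s2 s3.
Proof.
move=> th; have th' := theta_swap12 th.
have [gc Cc] := theta_cycle th.
have [p Cp bJ] := cycle_bounded_component dr gc; rewrite Cc in Cp bJ.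
have clK : closed (P s1 `|` P s2) by rewrite -Cc; exact: (cycle_curve_closed dr gc).
have h1 := theta_has_arg th Cp bJ.
have h2 : has_arg p (P s2 `|` P s3).
  by apply: (theta_has_arg th'); rewrite setUC.
have u12 := theta_uniq12 th.
case: (th) => -[p1 p2 p3] [n1 n2 n3 us].
have := has_angle_glue _ _ _ h1 h2.
(* The first two paths meet only in the ends [pt a] and [pt b], which lie on the third. *)
have -> : (P s1 `|` P s3) `&` (P s2 `|` P s3) = P s3.
  apply/seteqP; split=> [z [[h|//] [h'|//]]|z h]; last by split; right.
  have [->|->] := two_paths_inter p1 p2 u12 n1 h h'; first exact: (pcurve_head dr p3).
  by apply: (pcurve_mem dr p3); rewrite in_cons mem_rcons mem_head orbT.
move=> []; [|by apply: closedU; exact: (pcurve_closed dr)|exact: (pcurve_connected dr p3)|].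
  by apply: closedU; exact: (pcurve_closed dr).
move=> t ct th3.
apply: (no_arg_bounded (component_open clK) bJ _ (component_frontier clK)).
- by rewrite -Cc; exact: (cycle_curve_compact dr gc).
- exact: connected_component_refl.
- apply: (@has_angle_subset _ _ _ (P s1 `|` P s3 `|` (P s2 `|` P s3))); last by exists t.
  by move=> z [h|h]; [left; left|right; left].
Qed.

End Theta.

End Outerplane.

(** * The radius bound for outerplane graphs *)

Unset Implicit Arguments.
Set Strict Implicit.
Set Printing Implicit Defensive.

Theorem theorem4p3 (R : realType) (V : finType) (e : rel V)
    (pt : V -> R * R) (arc : V -> V -> set (R * R)) :
  simple_graph e ->
  two_connected e ->
  outerplane e pt arc ->
  (forall (F : set (R * R)) (l : nat),
     internal_face e pt arc F -> face_length e arc F l ->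
     l%:R <= (#|V|%:R + 2) / 4 :> R) ->
  (graph_radius e <= #|V| %/ 4 + 1)%N.
Proof.
move=> [e_sym e_irr] tc op faces.
have [|c [gc cV]] := hamiltonian_cycle e_sym tc.
  by move=> a b s1 s2 s3 p1 p2 p3 n1 n2 n3 us; exact: (no_theta e_sym op (conj (And3 p1 p2 p3) (And4 n1 n2 n3 us))).
apply: (hamiltonian_radius e_sym e_irr _ gc cV) => d gd ind.
have [F [iF lF]] := induced_cycle_face e_sym op gd ind.
by have := faces F _ iF lF; rewrite ler_pdivlMr// -(ler_nat R) natrM natrD mulrC.
Qed.
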